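(* Let $t<s\le n/2$ be integers (with $n$ sufficiently large) such that $s\le e^{2t}$, and suppose that at least one of the following holds: (a) there is a constant $\delta>0$ with $(s/t)^{1-\delta}\ge \log n$; or (b) $s/t\ge c\log n$ for some constant $c>0$, and there is a constant $\gamma>0$ with $\log t\ge (\log n)^{\gamma}$. Then there exists a graph $G$ on $n$ vertices with $$\alpha(G)\le C\,\frac{t}{\log (s/t)}\log (n/t),$$ where $C$ is a constant (depending only on the constants $\delta$, respectively $c,\gamma$), such that every induced subgraph of $G$ on $s$ vertices contains an independent set of size $t$.
   Context: All logarithms are natural. $\alpha(G)$ denotes the maximum size of an independent set in $G$. The statement is asymptotic: $n$ is large and the implied constant in the bound on $\alpha(G)$ does not depend on $n,s,t$. *)

(* Defs.v *)
From mathcomp Require Import all_boot.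
From Stdlib Require Import Reals.
Set Implicit Arguments. Unset Strict Implicit. Unset Printing Implicit Defensive.

Definition simple_graph (n : nat) (e : rel 'I_n) : Prop :=
  symmetric e /\ irreflexive e.

Definition independent (n : nat) (e : rel 'I_n) (S : {set 'I_n}) : bool :=
  [forall x in S, forall y in S, ~~ e x y].

Definition alpha (n : nat) (e : rel 'I_n) : nat :=
  \max_(S : {set 'I_n} | independent e S) #|S|.

(* Main.v *)
Require Import Defs.
From mathcomp Require Import all_boot zify.
From Stdlib Require Import Reals Lra.
From mathcomp Require Import ssrnat.
Set Implicit Arguments. Unset Strict Implicit. Unset Printing Implicit Defensive.

(** Take a random graph G(n, p) with p of order log(s/t) / t; the first moment
    method bounds its independence number by O(t / log(s/t) * log(n/t)).

    Suppose that an s-set S contains no independent t-set. Removing maximal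
    independent sets I_1, ..., I_k from S one after the other, with k about
    s / 2t, leaves s/2 vertices, each having a neighbour in each I_j. These
    k s / 2 events depend on disjoint sets of pairs and each fails with
    probability at least (s/t)^(-delta/2), so all of them hold with probability
    at most exp(- (s/8) (s/t)^(1 - delta/2)), which beats the n^(O(s)) choices of the
    sets. This settles (a), and (b) when s/t >= (log n)^2.

    If s/t < (log n)^2 in (b), then t exceeds any power of s/t, and with
    probability 1 - o(n^(-s)) the set S spans O(s^2 p) edges and fewer than
    s (s/t)^(1-eps) edge-disjoint triangles. Let F be a maximal edge-disjoint
    family of triangles. A partition of the low-degree vertices of S minimising a
    weighted number of monochromatic edges, those covered by F being heavy, has
    classes that avoid F, hence are triangle-free, and have small maximum
    degree; the bound of Shearer for triangle-free graphs then gives an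
    independent t-set in the largest class. *)

(** * Estimates *)

Lemma INR_leq (m n : nat) : (m <= n)%N -> (INR m <= INR n)%R.
Proof. by move=> h; apply: le_INR; apply/leP. Qed.

Lemma INR_ltn (m n : nat) : (m < n)%N -> (INR m < INR n)%R.
Proof. by move=> h; apply: lt_INR; apply/ltP. Qed.

Arguments INR_leq [m n] _.
Arguments INR_ltn [m n] _.

Lemma INR_gt0 (n : nat) : (0 < n)%N -> (0 < INR n)%R.
Proof. exact: INR_ltn. Qed.

Lemma INR_ge1 (n : nat) : (0 < n)%N -> (1 <= INR n)%R.
Proof. by case: n => // n _; rewrite S_INR; have := pos_INR n; lra. Qed.

Arguments INR_gt0 [n] _.
Arguments INR_ge1 [n] _.

Lemma INR_addn (m n : nat) : INR (m + n)%N = (INR m + INR n)%R.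
Proof. exact: plus_INR. Qed.

Lemma INR_muln (m n : nat) : INR (m * n)%N = (INR m * INR n)%R.
Proof. exact: mult_INR. Qed.

Lemma INR_subn (m n : nat) : (n <= m)%N -> INR (m - n)%N = (INR m - INR n)%R.
Proof. by move=> h; apply: minus_INR; apply/leP. Qed.

Lemma INR_expn (m n : nat) : INR (m ^ n)%N = (INR m ^ n)%R.
Proof.
elim: n => [|n IH]; first by rewrite expn0.
by rewrite expnS INR_muln IH.
Qed.

Lemma leq_bin_expn (n r : nat) : 'C(n, r) <= n ^ r.
Proof.
apply: leq_trans (_ : n ^_ r <= _); first by rewrite -bin_ffact leq_pmulr // fact_gt0.
elim: r => // r IH; rewrite ffactnSr expnSr leq_mul //; exact: leq_subr.
Qed.

Lemma sum_nat_bool (T : finType) (A : {set T}) (Q : pred T) :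
  \sum_(x in A) Q x = #|[set x in A | Q x]|.
Proof.
rewrite -sum1_card; under [RHS]eq_bigl => x do rewrite inE.
by rewrite [RHS]big_mkcondr; apply: eq_bigr => x _; case: (Q x).
Qed.

Lemma inv_INR_bounds (m : nat) : (0 < / INR m.+1 <= 1)%R.
Proof.
have m1 := INR_ge1 (ltn0Sn m); split; first by apply: Rinv_0_lt_compat; lra.
by rewrite -Rinv_1; apply: Rinv_le_contravar; lra.
Qed.

Lemma ln_leq (x y : R) : (0 < x)%R -> (x <= y)%R -> (ln x <= ln y)%R.
Proof.
move=> x0 xy; case: (Rle_lt_or_eq_dec _ _ xy) => [h|->]; last exact: Rle_refl.
exact/Rlt_le/ln_increasing.
Qed.

Lemma ln_div (x y : R) : (0 < x)%R -> (0 < y)%R -> ln (x / y) = (ln x - ln y)%R.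
Proof.
by move=> x0 y0; rewrite /Rdiv ln_mult ?ln_Rinv //; apply: Rinv_0_lt_compat.
Qed.

Lemma exp_leq (x y : R) : (x <= y)%R -> (exp x <= exp y)%R.
Proof.
move=> xy; case: (Rle_lt_or_eq_dec _ _ xy) => [h|->]; last exact: Rle_refl.
exact/Rlt_le/exp_increasing.
Qed.

Lemma pow_exp_ln (x : R) (k : nat) : (0 < x)%R -> (x ^ k = exp (INR k * ln x))%R.
Proof. by move=> x0; rewrite -Rpower_pow. Qed.

Lemma inv_exp2_lt : (/ exp 2 < / 3)%R.
Proof.
apply: Rinv_0_lt_contravar; first lra.
by have := exp_ineq1 2; lra.
Qed.

Lemma nat_above (x : R) : (0 <= x)%R -> exists k : nat, (x < INR k <= x + 1)%R.
Proof.
move=> x0; have [h1 h2] := archimed x.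
have z0 : (0 <= up x)%Z by apply: le_IZR; lra.
have [k ek] := IZN _ z0.
by exists k; rewrite INR_IZR_INZ -ek; lra.
Qed.

Lemma ln_INR_large (Y : R) :
  exists N : nat, forall n : nat, (N <= n)%N -> (0 < n)%N /\ (Y <= ln (INR n))%R.
Proof.
have [N [hN _]] := nat_above (Rlt_le _ _ (exp_pos Y)).
exists N => n /INR_leq Nn; have n0 : (0 < INR n)%R by have := exp_pos Y; lra.
split; first by case: n n0 {Nn} => //=; lra.
by rewrite -(ln_exp Y); apply: ln_leq; [exact: exp_pos | lra].
Qed.

(** A weak Stirling bound: raising [k] by one multiplies the left side by [(k + 1) (1 + 1/k)^k], and
    [(1 + 1/k)^k <= e <= 3]. *)
Lemma INR_fact_lower (k : nat) : (INR k ^ k <= 3 ^ k * INR k`!)%R.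
Proof.
elim: k => [|k IH]; first by rewrite /=; lra.
case: k IH => [|k] IH; first by rewrite /=; lra.
have k0 : (0 < INR k.+1)%R by apply: INR_gt0.
have step : ((1 + / INR k.+1) ^ k.+1 <= 3)%R.
  apply: Rle_trans exp_le_3.
  have -> : exp 1 = (exp (/ INR k.+1) ^ k.+1)%R.
    rewrite -Rpower_pow; last exact: exp_pos.
    by rewrite /Rpower ln_exp Rinv_r //; apply: Rgt_not_eq.
  apply: pow_incr; split; first by have := Rinv_0_lt_compat _ k0; lra.
  exact: exp_ineq1_le.
have e1 : INR k.+2 = (INR k.+1 * (1 + / INR k.+1))%R.
  rewrite S_INR Rmult_plus_distr_l Rinv_r ?Rmult_1_r //; exact: Rgt_not_eq.
rewrite factS INR_muln [(INR k.+2 ^ _)%R]/= -/(pow _ k.+1) [(3 ^ _)%R]/= -/(pow _ k.+1).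
have h : (INR k.+2 ^ k.+1 <= 3 * (3 ^ k.+1 * INR k.+1`!))%R.
  rewrite {1}e1 Rpow_mult_distr Rmult_comm.
  apply: Rmult_le_compat => //.
  - by apply: pow_le; have := Rinv_0_lt_compat _ k0; lra.
  - by apply: pow_le; lra.
have := Rmult_le_compat_l (INR k.+2) _ _ (pos_INR _) h.
rewrite /=; lra.
Qed.

Lemma INR_bin_upper (N k : nat) :
  (0 < k)%N -> (INR 'C(N, k) <= (3 * INR N / INR k) ^ k)%R.
Proof.
move=> k0.
have k0' : (0 < INR k)%R by apply: INR_gt0.
have h1 : (INR 'C(N, k) * INR k`! <= INR N ^ k)%R.
  rewrite -INR_muln -INR_expn bin_ffact; apply: INR_leq.
  elim: k {k0 k0'} => [|k IH] //.
  by rewrite ffactnSr expnSr leq_mul // leq_subr.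
have h2 := INR_fact_lower k.
have kk : (0 < INR k ^ k)%R by apply: pow_lt.
have -> : ((3 * INR N / INR k) ^ k = 3 ^ k * INR N ^ k / INR k ^ k)%R.
  by rewrite /Rdiv !Rpow_mult_distr pow_inv.
apply: (Rmult_le_reg_r (INR k ^ k)) => //.
rewrite /Rdiv Rmult_assoc Rinv_l; last exact: Rgt_not_eq.
rewrite Rmult_1_r.
have p3 : (0 <= 3 ^ k)%R by apply: pow_le; lra.
have := Rmult_le_compat_l _ _ _ (pos_INR 'C(N, k)) h2.
have := Rmult_le_compat_l _ _ _ p3 h1.
lra.
Qed.

Lemma pow_1_minus_le_exp (x : R) (k : nat) :
  (0 <= x <= 1)%R -> ((1 - x) ^ k <= exp (- (x * INR k)))%R.
Proof.
move=> hx.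
have -> : exp (- (x * INR k)) = (exp (- x) ^ k)%R.
  rewrite -Rpower_pow; last exact: exp_pos.
  by rewrite /Rpower ln_exp; congr exp; ring.
by apply: pow_incr; split; [lra | have := exp_ineq1_le (- x); lra].
Qed.

(** [(1 + 2x)(1 - x) >= 1] on [[0, 1/2]], so [1 - x >= exp (-2x)] there. *)
Lemma exp_le_pow_1_minus (x : R) (k : nat) :
  (0 <= x <= / 2)%R -> (exp (- (2 * x * INR k)) <= (1 - x) ^ k)%R.
Proof.
move=> hx.
have -> : exp (- (2 * x * INR k)) = (exp (- (2 * x)) ^ k)%R.
  rewrite -Rpower_pow; last exact: exp_pos.
  by rewrite /Rpower ln_exp; congr exp; ring.
apply: pow_incr; split; first by apply: Rlt_le; exact: exp_pos.
rewrite exp_Ropp.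
apply: (Rmult_le_reg_l (exp (2 * x))); first exact: exp_pos.
rewrite Rinv_r; last by apply: Rgt_not_eq; exact: exp_pos.
have := exp_ineq1_le (2 * x) => h.
have : ((1 + 2 * x) * (1 - x) <= exp (2 * x) * (1 - x))%R.
  by apply: Rmult_le_compat_r; lra.
nra.
Qed.

(** * Uniform random colourings *)

(** Probability as counting: the elements of [T] receive independent uniform colours, a fixed colour
    having probability [1 / (m + 1)] at each. The index [m.+1] keeps the sample space nonempty. *)
Definition Pr (T : finType) (m : nat) (A : {set {ffun T -> 'I_m.+1}}) : R :=
  (INR #|A| / INR #|{ffun T -> 'I_m.+1}|)%R.

Lemma card_sample_gt0 (T : finType) (m : nat) :
  (0 < INR #|{ffun T -> 'I_m.+1}|)%R.
Proof. by rewrite card_ffun card_ord; apply: lt_0_INR; apply/ltP; rewrite expn_gt0. Qed.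

Lemma Pr_le (T : finType) (m : nat) (A B : {set {ffun T -> 'I_m.+1}}) :
  A \subset B -> (Pr A <= Pr B)%R.
Proof.
move=> h; apply: Rmult_le_compat_r; last by apply: INR_leq; apply: subset_leq_card.
by apply/Rlt_le/Rinv_0_lt_compat/card_sample_gt0.
Qed.

Lemma Pr_setU (T : finType) (m : nat) (A B : {set {ffun T -> 'I_m.+1}}) :
  (Pr (A :|: B) <= Pr A + Pr B)%R.
Proof.
rewrite /Pr /Rdiv -Rmult_plus_distr_r -INR_addn.
apply: Rmult_le_compat_r; last by apply: INR_leq; rewrite cardsU leq_subr.
by apply/Rlt_le/Rinv_0_lt_compat/card_sample_gt0.
Qed.

Lemma Pr_bigcup (T I : finType) (m : nat) (D : {set I})
    (E : I -> {set {ffun T -> 'I_m.+1}}) (x : R) :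
  (forall i, i \in D -> Pr (E i) <= x)%R ->
  (Pr (\bigcup_(i in D) E i) <= INR #|D| * x)%R.
Proof.
move=> h; rewrite -big_enum cardE.
have : {subset enum D <= D} by move=> i; rewrite mem_enum.
elim: (enum D) => [|i r IH] hr.
  by rewrite big_nil /Pr cards0 /=; lra.
rewrite big_cons.
apply: Rle_trans (Pr_setU _ _) _.
have -> : INR (size (i :: r)) = (INR (size r) + 1)%R by rewrite -S_INR.
rewrite Rmult_plus_distr_r Rmult_1_l Rplus_comm.
apply: Rplus_le_compat; last exact: h (hr i (mem_head _ _)).
by apply: IH => j hj; apply: hr; rewrite inE hj orbT.
Qed.

Lemma Pr_lt1_exists (T : finType) (m : nat) (A : {set {ffun T -> 'I_m.+1}}) :
  (Pr A < 1)%R -> exists w, w \notin A.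
Proof.
move=> h; case: (boolP [exists w, w \notin A]) => [/existsP //|/existsPn hA].
have : Pr A = 1%R; last by lra.
rewrite /Pr (_ : #|A| = #|{ffun T -> 'I_m.+1}|).
  by rewrite /Rdiv Rinv_r //; apply: Rgt_not_eq; exact: card_sample_gt0.
by apply: eq_card => w; have := hA w; rewrite negbK => ->.
Qed.

(** Independence of distinct coordinates, by counting: [#|Q|] choices at each point of [X], all
    [m + 1] colours elsewhere. *)
Lemma Pr_rect (T : finType) (m : nat) (X : {set T}) (Q : {pred 'I_m.+1}) :
  Pr [set w : {ffun T -> 'I_m.+1} | [forall x in X, w x \in Q]]
    = ((INR #|Q| / INR m.+1) ^ #|X|)%R.
Proof.
have c : #|[set w : {ffun T -> 'I_m.+1} | [forall x in X, w x \in Q]]|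
    = (#|Q| ^ #|X| * m.+1 ^ #|~: X|)%N.
  transitivity #|finfun.family (fun x : T => if x \in X then Q else {: 'I_m.+1})|.
    apply: eq_card => w; rewrite inE; apply/forallP/familyP => h x.
      by have := h x; case: (x \in X).
    by have := h x; case: (x \in X) => //=; rewrite implybT.
  rewrite card_family foldrE big_map big_enum /=.
  rewrite (bigID (mem X)) /=; congr muln.
    by rewrite -prod_nat_const; apply: eq_bigr => x ->.
  rewrite -[X in _ = X ^ _]card_ord -prod_nat_const.
  by apply: eq_big => [x|x /negbTE ->] //; rewrite inE.
rewrite /Pr c card_ffun card_ord -(cardsC X) expnD !INR_muln !INR_expn.
rewrite /Rdiv Rpow_mult_distr pow_inv.
have m0 : (0 < INR m.+1)%R by apply: INR_gt0.
field; split; apply: Rgt_not_eq; exact: pow_lt.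
Qed.

Lemma card_ord_neq0 (m : nat) : #|[pred i : 'I_m.+1 | i != ord0]| = m.
Proof. by have := cardC1 (ord0 : 'I_m.+1); rewrite card_ord. Qed.

Lemma Pr_avoid (T : finType) (m : nat) (X : {set T}) :
  Pr [set w : {ffun T -> 'I_m.+1} | [forall x in X, w x != ord0]]
    = ((1 - / INR m.+1) ^ #|X|)%R.
Proof.
rewrite (Pr_rect X [pred i : 'I_m.+1 | i != ord0]) card_ord_neq0; congr pow.
have m0 : (0 < INR m.+1)%R by apply: INR_gt0.
rewrite -[m in INR m](subn1 m.+1) INR_subn //=; field; exact: Rgt_not_eq.
Qed.

Lemma Pr_all0 (T : finType) (m : nat) (X : {set T}) :
  Pr [set w : {ffun T -> 'I_m.+1} | [forall x in X, w x == ord0]]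
    = ((/ INR m.+1) ^ #|X|)%R.
Proof.
rewrite (Pr_rect X (pred1 (ord0 : 'I_m.+1))) card1; congr pow.
by rewrite /Rdiv Rmult_1_l.
Qed.

Definition hits (T : finType) (m : nat) (bs : seq {set T}) (w : {ffun T -> 'I_m.+1}) :=
  all (fun B : {set T} => [exists x in B, w x == ord0]) bs.

(* The event "avoid X and hit B" is "avoid X" minus "avoid X :|: B", which
   makes the independence of disjoint blocks an induction on their number. *)
Lemma Pr_avoid_hits (T : finType) (m : nat) (X : {set T}) (bs : seq {set T}) :
  pairwise (fun A B : {set T} => [disjoint A & B]) (X :: bs) ->
  Pr [set w : {ffun T -> 'I_m.+1} | [forall x in X, w x != ord0] && hits bs w]
    = ((1 - / INR m.+1) ^ #|X| *
       foldr (fun B : {set T} => Rmult (1 - (1 - / INR m.+1) ^ #|B|)) 1 bs)%R.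
Proof.
elim: bs X => [|B bs IH] X.
  move=> _; rewrite /= Rmult_1_r -Pr_avoid.
  by congr Pr; apply/setP => w; rewrite !inE andbT.
rewrite pairwise_cons [all _ _]/= [pairwise _ _]/= => /andP[/andP[XB Xbs] /andP[Bbs pw]].
have pX : pairwise (fun A B : {set T} => [disjoint A & B]) (X :: bs).
  by rewrite pairwise_cons Xbs pw.
have pXB : pairwise (fun A B : {set T} => [disjoint A & B]) ((X :|: B) :: bs).
  rewrite pairwise_cons pw andbT; apply/allP => C hC.
  rewrite -setI_eq0 setIUl setU_eq0 !setI_eq0.
  by rewrite (allP Xbs) // (allP Bbs).
have := IH _ pX; have := IH _ pXB.
set A2 := [set w | _ ]; set A1 := [set w | _].
move=> e2 e1.
have s21 : A2 \subset A1.
  apply/subsetP => w; rewrite !inE => /andP[/forallP h ->]; rewrite andbT.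
  by apply/forallP => x; apply/implyP => xX; apply: (implyP (h x)); rewrite inE xX.
have -> : [set w : {ffun T -> 'I_m.+1} | [forall x in X, w x != ord0] && hits (B :: bs) w]
    = A1 :\: A2.
  apply/setP => w; rewrite !inE /hits /=.
  set hb := all _ bs; case: hb; rewrite ?andbF // !andbT.
  apply/andP/andP => -[].
    move=> hX /existsP[x /andP[xB wx]]; split=> //.
    apply/negP => /forallP /(_ x); by rewrite inE xB orbT /= wx.
  move=> hXB hX; split=> //.
  case/forallPn: hXB => x; rewrite negb_imply negbK inE => /andP[/orP[xX|xB] wx].
    by have := forallP hX x; rewrite xX wx.
  by apply/existsP; exists x; rewrite xB.
have -> : Pr (A1 :\: A2) = (Pr A1 - Pr A2)%R.
  rewrite /Pr cardsD (setIidPr s21) INR_subn ?subset_leq_card //.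
  by rewrite /Rdiv; ring.
have cXB : #|X :|: B| = (#|X| + #|B|)%N.
  by rewrite cardsU disjoint_setI0 // cards0 subn0.
by rewrite e1 e2 cXB /= Rdef_pow_add; ring.
Qed.

(** With nothing to avoid, [Pr_avoid_hits] gives an exact product, whose factors only grow when
    [#|B|] is raised to [t]. *)
Lemma Pr_hits (T : finType) (m t : nat) (bs : seq {set T}) :
  pairwise (fun A B : {set T} => [disjoint A & B]) bs ->
  all (fun B : {set T} => #|B| <= t) bs ->
  (Pr [set w : {ffun T -> 'I_m.+1} | hits bs w]
     <= (1 - (1 - / INR m.+1) ^ t) ^ size bs)%R.
Proof.
move=> pw small.
have pw0 : pairwise (fun A B : {set T} => [disjoint A & B]) (set0 :: bs).
  rewrite pairwise_cons pw andbT; apply/allP => B _.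
  by rewrite -setI_eq0 set0I.
have -> : [set w : {ffun T -> 'I_m.+1} | hits bs w] =
    [set w : {ffun T -> 'I_m.+1} | [forall x in (set0 : {set T}), w x != ord0] && hits bs w].
  apply/setP => w; rewrite !inE; suff -> : [forall x in (set0 : {set T}), w x != ord0] by [].
  by apply/forallP => x; rewrite inE.
rewrite Pr_avoid_hits // cards0 pow_O Rmult_1_l {pw pw0}.
have q0 : (0 <= 1 - / INR m.+1 <= 1)%R by have := inv_INR_bounds m; lra.
have q1 k : (0 <= (1 - / INR m.+1) ^ k <= 1)%R.
  by split; [apply: pow_le; lra | rewrite -[X in (_ <= X)%R](pow1 k); apply: pow_incr; lra].
move: (1 - / INR m.+1)%R q0 q1 => q q0 q1.
suff : (0 <= foldr (fun B : {set T} => Rmult (1 - q ^ #|B|)) 1 bs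
     <= (1 - q ^ t) ^ size bs)%R by case.
elim: bs small => [|B bs IH] /=; first by lra.
move=> /andP[Bt /IH {}IH].
have Bt' : (q ^ t <= q ^ #|B|)%R.
  rewrite -(subnKC Bt) Rdef_pow_add -[X in (_ <= X)%R]Rmult_1_r.
  by apply: Rmult_le_compat_l; [case: (q1 #|B|) | case: (q1 (t - #|B|))].
have := q1 #|B|; split; first by apply: Rmult_le_pos; lra.
by apply: Rmult_le_compat; lra.
Qed.

(** * The independence number of a random graph *)

(* Sampling uniformly with [m + 1] colours per pair gives a random graph with
   edge probability [1 / (m + 1)]. *)
Definition gedge (n m : nat) (w : {ffun {set 'I_n} -> 'I_m.+1}) : rel 'I_n :=
  fun u v => (u != v) && (w [set u; v] == ord0).

Lemma gedge_simple (n m : nat) (w : {ffun {set 'I_n} -> 'I_m.+1}) :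
  simple_graph (gedge w).
Proof.
by split=> [u v|u]; rewrite /gedge ?eqxx // eq_sym setUC.
Qed.

Definition pairs (n : nat) (S : {set 'I_n}) : {set {set 'I_n}} :=
  [set A : {set 'I_n} | A \subset S & #|A| == 2].

Lemma card_pairs (n : nat) (S : {set 'I_n}) : #|pairs S| = 'C(#|S|, 2).
Proof. exact: cards_draws. Qed.

Lemma independent_subset (n : nat) (e : rel 'I_n) (A B : {set 'I_n}) :
  A \subset B -> independent e B -> independent e A.
Proof.
move=> /subsetP AB /forall_inP h; apply/forall_inP => x xA; apply/forall_inP => y yA.
by have /forall_inP := h x (AB x xA); apply; apply: AB.
Qed.

Lemma subset_of_card (T : finType) (A : {set T}) (r : nat) :
  r <= #|A| -> exists B : {set T}, B \subset A /\ #|B| = r.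
Proof.
move=> h; have : 0 < #|[set B : {set T} | B \subset A & #|B| == r]|.
  by rewrite cards_draws bin_gt0.
by case/card_gt0P => B; rewrite inE => /andP[sB /eqP cB]; exists B.
Qed.

Lemma independent_of_alpha (n r : nat) (e : rel 'I_n) :
  r <= alpha e -> exists2 A : {set 'I_n}, #|A| = r & independent e A.
Proof.
have i0 : independent e set0 by apply/forall_inP => x; rewrite inE.
rewrite /alpha (bigmax_eq_arg set0 i0).
case: arg_maxnP => // A hA _ /subset_of_card[B [BA cB]].
by exists B => //; apply: independent_subset hA.
Qed.

(** First moment: at most [(3n/r)^r] candidate sets, each independent with probability
    [(1 - p)^(r(r-1)/2)], where [p = 1/(m+1)]. *)
Lemma Pr_alpha_ge (n m r : nat) : 0 < r ->
  (Pr [set w : {ffun {set 'I_n} -> 'I_m.+1} | (r <= alpha (gedge w))%N]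
    <= (3 * INR n / INR r * exp (- ((INR r - 1) / (2 * INR m.+1)))) ^ r)%R.
Proof.
move=> r0; have r1 := INR_gt0 r0.
pose D := [set S : {set 'I_n} | #|S| == r].
pose E (S : {set 'I_n}) : {set {ffun {set 'I_n} -> 'I_m.+1}} :=
  [set w : {ffun {set 'I_n} -> 'I_m.+1} | [forall x in pairs S, w x != ord0]].
apply: Rle_trans (_ : _ <= Pr (\bigcup_(S in D) E S))%R _.
  apply: Pr_le; apply/subsetP => w; rewrite inE => /independent_of_alpha[A cA iA].
  apply/bigcupP; exists A; rewrite inE ?cA //.
  apply/forall_inP => B; rewrite inE => /andP[/subsetP BA /cards2P[x [y [xy eB]]]].
  have xA : x \in A by apply: BA; rewrite eB !inE eqxx.
  have yA : y \in A by apply: BA; rewrite eB !inE eqxx orbT.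
  have /forall_inP := forall_inP iA x xA => /(_ y yA).
  by rewrite /gedge xy eB.
have M0 := INR_gt0 (ltn0Sn m).
have iM : (0 <= / INR m.+1 <= 1)%R by have := inv_INR_bounds m; lra.
apply: Rle_trans (_ : _ <= INR #|D| * (1 - / INR m.+1) ^ 'C(r, 2))%R _.
  apply: Pr_bigcup => S; rewrite inE => /eqP cS.
  by rewrite Pr_avoid card_pairs cS; exact: Rle_refl.
have -> : #|D| = 'C(n, r) by rewrite card_draws card_ord.
rewrite Rpow_mult_distr; apply: Rmult_le_compat.
- exact: pos_INR.
- by apply: pow_le; lra.
- exact: INR_bin_upper.
apply: Rle_trans (pow_1_minus_le_exp _ iM) _; apply: Req_le.
have c2 : (2 * INR 'C(r, 2) = INR r * (INR r - 1))%R.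
  by have := congr1 INR (mul_bin_left r 1); rewrite bin1 !INR_muln INR_subn //=; lra.
rewrite -Rpower_pow; last exact: exp_pos.
rewrite /Rpower ln_exp; congr exp.
have -> : INR 'C(r, 2) = (INR r * (INR r - 1) / 2)%R by lra.
by field; lra.
Qed.

(** With [L = ln (s/t)] and [N = ln (n/t)], the last hypothesis says that the edge probability is at
    least [a L / t]. For [r] just above [C (t/L) N], [C >= 9] gives [3n/r <= e^N / 3] and [C a >= 4]
    gives [(r - 1)/(2(m + 1)) >= N], so the base of the first moment bound is at most [1/3]. *)
Lemma Pr_alpha_le (C a : R) (n s t m : nat) :
  (9 <= C)%R -> (4 <= C * a)%R -> (0 < t)%N -> (t < s)%N -> (2 * s <= n)%N ->
  (INR s <= exp (2 * INR t))%R ->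
  (a * INR m.+1 * ln (INR s / INR t) <= INR t)%R ->
  exists r : nat,
    (INR r <= C * (INR t / ln (INR s / INR t)) * ln (INR n / INR t) + 1)%R /\
    (Pr [set w : {ffun {set 'I_n} -> 'I_m.+1} | (r <= alpha (gedge w))%N] <= / 3)%R.
Proof.
move=> C9 Ca t0 ts sn st am.
have t0' := INR_gt0 t0; have ts' := INR_ltn ts.
have t1 := INR_ge1 t0.
have sn' := INR_leq sn; rewrite INR_muln [INR 2]/= in sn'.
have lt0 : (0 <= ln (INR t))%R by rewrite -ln_1; apply: ln_leq; lra.
have ts0 : (0 < INR s)%R by lra.
have L0 : (0 < ln (INR s / INR t))%R.
  by rewrite ln_div; last lra; last lra; have := ln_increasing _ _ t0' ts'; lra.
have L2 : (ln (INR s / INR t) <= 2 * INR t)%R.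
  rewrite ln_div; last lra; last lra.
  by have := ln_leq ts0 st; rewrite ln_exp; lra.
have LN : (ln 2 + ln (INR s / INR t) <= ln (INR n / INR t))%R.
  rewrite !ln_div; try lra.
  have := @ln_leq (2 * INR s) (INR n) ltac:(lra) ltac:(lra).
  by rewrite ln_mult; lra.
have l2 := ln_lt_2.
move: L0 L2 LN am; set L := ln (INR s / INR t); set N := ln (INR n / INR t) => L0 L2 LN am.
have tL : (/ 2 <= INR t / L)%R.
  by apply: (Rmult_le_reg_r L) => //; rewrite /Rdiv Rmult_assoc Rinv_l; lra.
set X := (C * (INR t / L) * N)%R.
have XN : (C * / 2 * N <= X)%R.
  by apply: Rmult_le_compat_r; [lra | apply: Rmult_le_compat_l; lra].
(* Used below as [2 (r - 1) >= X]. It rests on [t / L >= 1/2], a consequence of [s <= exp (2t)], and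
   on [N >= ln 2 + L]. *)
have X2 : (2 <= X)%R by nra.
have [r [Xr rX]] := @nat_above X ltac:(lra).
have r0 : 0 < r by case: (posnP r) Xr => // -> /=; lra.
exists r; split=> //.
apply: Rle_trans (Pr_alpha_ge _ _ r0) _.
have M0 := INR_gt0 (ltn0Sn m).
set y := (_ * exp _)%R.
have y0 : (0 <= y)%R.
  apply: Rmult_le_pos; last exact/Rlt_le/exp_pos.
  by apply/Rlt_le/Rdiv_lt_0_compat; lra.
have eN : exp N = (INR n / INR t)%R.
  by rewrite exp_ln //; apply: Rdiv_lt_0_compat; lra.
have y3 : (y <= / 3)%R.
  have e1 : (3 * INR n / INR r <= / 3 * exp N)%R.
    have h1 : (C * INR t <= INR r)%R.
      apply: Rle_trans (Rlt_le _ _ Xr); rewrite /X /Rdiv Rmult_assoc.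
      have : (1 <= / L * N)%R.
        by apply: (Rmult_le_reg_l L) => //; rewrite -Rmult_assoc Rinv_r; lra.
      move=> h; have := Rmult_le_compat_l (C * INR t) _ _ ltac:(nra) h; lra.
    rewrite eN; apply: (Rmult_le_reg_r (INR r)); first lra.
    apply: (Rmult_le_reg_r (INR t)); first lra.
    have -> : (3 * INR n / INR r * INR r * INR t = 3 * INR n * INR t)%R by field; lra.
    have -> : (/ 3 * (INR n / INR t) * INR r * INR t = / 3 * INR n * INR r)%R by field; lra.
    have h2 : (9 * INR t <= INR r)%R by nra.
    by have := Rmult_le_compat_l _ _ _ (pos_INR n) h2; lra.
  have e2 : (N <= (INR r - 1) / (2 * INR m.+1))%R.
    apply: (Rmult_le_reg_r (4 * INR m.+1)); first lra.
    have -> : ((INR r - 1) / (2 * INR m.+1) * (4 * INR m.+1) = 2 * (INR r - 1))%R by field; lra.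
    suff : (4 * INR m.+1 * N <= X)%R by lra.
    rewrite /X.
    apply: Rmult_le_compat_r; first lra.
    apply: (Rmult_le_reg_r L) => //.
    have -> : (C * (INR t / L) * L = C * INR t)%R by field; lra.
    have := Rmult_le_compat_l C _ _ ltac:(lra) am.
    have : (4 * (INR m.+1 * L) <= C * a * (INR m.+1 * L))%R.
      by apply: Rmult_le_compat_r => //; apply/Rlt_le/Rmult_lt_0_compat.
    lra.
  apply: Rle_trans (_ : _ <= / 3 * exp N * exp (- N))%R _.
    apply: Rmult_le_compat => //.
    - by apply/Rlt_le/Rdiv_lt_0_compat; lra.
    - exact/Rlt_le/exp_pos.
    - by apply: exp_leq; lra.
  by rewrite Rmult_assoc -exp_plus Rplus_opp_r exp_0; lra.
case: r r0 {Xr rX} y y0 y3 => // r _ y y0 y3; rewrite /=.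
have : (y ^ r <= 1)%R by rewrite -(pow1 r); apply: pow_incr; lra.
have := pow_le y r y0; nra.
Qed.

(** * Sets without independent sets of size [t]: the greedy certificate *)

Definition no_independent (n : nat) (e : rel 'I_n) (t : nat) (S : {set 'I_n}) : bool :=
  [forall T : {set 'I_n}, (T \subset S) && (#|T| == t) ==> ~~ independent e T].

Lemma no_independent_card (n : nat) (e : rel 'I_n) (t : nat) (S T : {set 'I_n}) :
  no_independent e t S -> T \subset S -> independent e T -> #|T| < t.
Proof.
move=> /forallP noS TS iT; rewrite ltnNge; apply/negP => /subset_of_card[B [BT cB]].
have := noS B; rewrite (subset_trans BT TS) cB eqxx /= => /negP; apply.
exact: independent_subset iT.
Qed.

(** Each [I j] is a largest independent set among the vertices of [S] outside the earlier ones. A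
    vertex that is never taken could be added to [I j] unless it has a neighbour there. *)
Lemma greedy_independent_sets (n : nat) (e : rel 'I_n) (t k : nat) (S : {set 'I_n}) :
  simple_graph e -> no_independent e t S ->
  exists I : nat -> {set 'I_n},
    [/\ forall j, j < k -> I j \subset S /\ #|I j| < t,
        forall i j, i < j < k -> [disjoint I i & I j] &
        forall v, v \in S -> (forall j, j < k -> v \notin I j) ->
          forall j, j < k -> [exists u in I j, e v u]].
Proof.
move=> [esym eirr] noS; elim: k => [|k [I [I1 I2 I3]]].
  by exists (fun => set0); split=> // i j; rewrite ltn0 andbF.
pose Z := [set v in S | [forall j : 'I_k, v \notin I j]].
pose P (A : {set 'I_n}) := (A \subset Z) && independent e A.
have P0 : P set0 by rewrite /P sub0set; apply/forall_inP => x; rewrite inE.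
case: (@arg_maxnP _ set0 P (fun A : {set 'I_n} => #|A|) P0) => A /andP[AZ iA] Amax.
have AS : A \subset S by apply: subset_trans AZ _; apply/subsetP => v; rewrite inE => /andP[].
exists (fun j => if j == k then A else I j); split.
- move=> j; rewrite ltnS leq_eqVlt; case: eqP => [_ _|_ /= /I1 //].
  by split=> //; apply: no_independent_card AS iA.
- move=> i j /andP[ij]; rewrite ltnS leq_eqVlt => /orP[/eqP jk|jk].
    subst j; rewrite eqxx ltn_eqF //; rewrite disjoint_sym.
    apply/pred0P => v /=; apply/negP => /andP[/(subsetP AZ)]; rewrite inE => /andP[_].
    by move=> /forallP/(_ (Ordinal ij)) /= /negbTE ->.
  by rewrite !ltn_eqF //; [apply: I2; rewrite ij | apply: ltn_trans jk].
move=> v vS vI.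
have vI' j : j < k -> v \notin I j.
  by move=> jk; have := vI j (ltnW jk); rewrite ltn_eqF.
move=> j; rewrite ltnS leq_eqVlt; case: eqP => [_ _|_ /=]; last exact: I3.
have vA : v \notin A by have := vI k (ltnSn k); rewrite eqxx.
apply: contraT => /exists_inPn nov.
have : P (v |: A).
  rewrite /P subUset AZ andbT sub1set inE vS /=; apply/andP; split.
    by apply/forallP => i; apply: vI'.
  apply/forall_inP => x; rewrite !inE => /orP[/eqP->|xA]; apply/forall_inP => y;
    rewrite !inE => /orP[/eqP->|yA].
  - by rewrite eirr.
  - exact: nov.
  - by rewrite esym nov.
  - exact: (forall_inP (forall_inP iA x xA)).
by move=> /Amax /=; rewrite cardsU1 vA add1n ltnn.
Qed.

(** Such a set is the set of vertices among the values of some function from ['I_t] to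
    [option 'I_n]; the value [None] pads the smaller sets. *)
Lemma card_small_sets (n t : nat) : #|[set A : {set 'I_n} | #|A| <= t]| <= n.+1 ^ t.
Proof.
pose F (f : {ffun 'I_t -> option 'I_n}) := [set x : 'I_n | Some x \in codom f].
apply: leq_trans (_ : #|F @: setT| <= _).
  apply/subset_leq_card/subsetP => A; rewrite inE => At.
  apply/imsetP; exists [ffun i : 'I_t => nth None [seq Some x | x <- enum A] i] => //.
  apply/setP => x; rewrite inE; apply/idP/codomP => [xA|[i]].
    have xi : index x (enum A) < #|A| by rewrite cardE index_mem mem_enum.
    exists (Ordinal (leq_trans xi At)); rewrite ffunE /=.
    by rewrite (nth_map x) -?cardE // nth_index // mem_enum.
  rewrite ffunE; case: (ltnP i (size (enum A))) => [iA|iA].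
    by rewrite (nth_map x) // => -[->]; rewrite -mem_enum mem_nth.
  by rewrite nth_default // size_map.
apply: leq_trans (leq_imset_card _ _) _.
by rewrite cardsT card_ffun card_option !card_ord.
Qed.

(** A certificate consists of [s - k t] untaken vertices [R] and the [k] greedy sets; there are at
    most [(n+1)^s] of them. For [v] in [R] and each [j], some pair from [v] to [I j] must be an
    edge, and these [(s - k t) k] blocks of pairs are disjoint. *)
Lemma Pr_no_independent (n m s t k : nat) : k * t <= s ->
  (Pr [set w : {ffun {set 'I_n} -> 'I_m.+1} |
        [exists S : {set 'I_n}, (#|S| == s) && no_independent (gedge w) t S]]
    <= INR n.+1 ^ s * (1 - (1 - / INR m.+1) ^ t) ^ ((s - k * t) * k))%R.
Proof.
move=> kts; pose r := s - k * t.
pose small := [set A : {set 'I_n} | #|A| <= t].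
pose D := [set c : {set 'I_n} * {ffun 'I_k -> {set 'I_n}} |
  [&& #|c.1| == r, c.2 \in ffun_on (mem small),
     [forall j, [disjoint c.1 & c.2 j]] &
     [forall i, forall j, (i != j) ==> [disjoint c.2 i & c.2 j]]]].
pose blocks (c : {set 'I_n} * {ffun 'I_k -> {set 'I_n}}) : seq {set {set 'I_n}} :=
  [seq [set [set p.1; u] | u in c.2 p.2] | p <- enum (setX c.1 [set: 'I_k])].
pose E c : {set {ffun {set 'I_n} -> 'I_m.+1}} :=
  [set w : {ffun {set 'I_n} -> 'I_m.+1} | hits (blocks c) w].
have cD : (INR #|D| <= INR n.+1 ^ s)%R.
  rewrite -INR_expn; apply: INR_leq.
  apply: leq_trans (_ : #|setX [set R : {set 'I_n} | #|R| == r]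
      [set I : {ffun 'I_k -> {set 'I_n}} | I \in ffun_on (mem small)]| <= _).
    by apply/subset_leq_card/subsetP => c; rewrite !inE => /and4P[-> ->].
  rewrite cardsX card_draws card_ord cardsE card_ffun_on card_ord.
  have -> : n.+1 ^ s = n.+1 ^ r * (n.+1 ^ t) ^ k.
    by rewrite -expnM -expnD [t * k]mulnC subnK.
  apply: leq_mul; last first.
    rewrite (eq_card (_ : _ =i small)) //; case: (posnP k) => [->|k0] //.
    by rewrite leq_exp2r //; apply: card_small_sets.
  by apply: leq_trans (leq_bin_expn n r) _; case: (r) => // i; rewrite leq_exp2r.
have PE c : c \in D -> (Pr (E c) <= (1 - (1 - / INR m.+1) ^ t) ^ (r * k))%R.
  case: c => R I; rewrite inE /= => /and4P[/eqP cR /ffun_onP Ismall /forallP RI /forallP II].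
  have <- : size (blocks (R, I)) = r * k.
    by rewrite size_map -cardE cardsX cardsT card_ord cR.
  have RIn v j : v \in R -> v \in I j -> False.
    by move=> vR vI; have := RI j => /pred0P /(_ v) /=; rewrite vR vI.
  apply: Pr_hits; last first.
    apply/allP => B /mapP[[v j] _ ->]; apply: leq_trans (leq_imset_card _ _) _.
    by have := Ismall j; rewrite inE.
  rewrite /blocks pairwise_map.
  have : pairwise [rel x y | x != y] (enum (setX R [set: 'I_k])).
    by rewrite -uniq_pairwise enum_uniq.
  apply: (@sub_in_pairwise _ (mem (setX R [set: 'I_k]))); last first.
    by apply/allP => x; rewrite mem_enum.
  (* A pair [{v, u}] determines its block: [v] is its only element in [R], and [u] lies in only one
     [I j]. *)
  move=> [v j] [v' j']; rewrite !inE /= !andbT => vR vR' ne.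
  apply/pred0P => A /=; apply/negP => /andP[/imsetP[u uI ->] /imsetP[u' uI' eA]].
  have : v \in [set v'; u'] by rewrite -eA !inE eqxx.
  have : u \in [set v'; u'] by rewrite -eA !inE eqxx orbT.
  rewrite !inE => /orP[/eqP uv|/eqP uu].
    by move=> _; apply: (RIn v' j) => //; rewrite -uv.
  move=> /orP[/eqP vv|/eqP vu]; last by apply: (RIn v j') => //; rewrite vu.
  have jj : j != j' by apply: contra ne => /eqP ->; rewrite vv.
  have /forallP /(_ j') := II j; rewrite jj /= => /pred0P /(_ u) /=.
  by rewrite uI uu uI'.
apply: Rle_trans (_ : _ <= Pr (\bigcup_(c in D) E c))%R _.
  apply: Pr_le; apply/subsetP => w; rewrite inE => /existsP[S /andP[/eqP cS noS]].
  have [I [I1 I2 I3]] := greedy_independent_sets k (gedge_simple w) noS.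
  pose U := \bigcup_(j < k) I j.
  have cU : #|U| <= k * t.
    apply: leq_trans (_ : \sum_(j < k) #|I j| <= _).
      rewrite /U; elim/big_rec2: _ => [|j B x _ hx]; first by rewrite cards0.
      by apply: (@leq_trans (#|I j| + #|x|)); rewrite ?cardsU ?leq_subr ?leq_add2l.
    rewrite -[X in X * t](card_ord k) -sum_nat_const; apply: leq_sum => i _.
    by apply: ltnW; case: (I1 i).
  (* The untaken vertices are cut down to exactly [r], as the count of certificates requires. *)
  have [R [RSU cR]] : exists R : {set 'I_n}, R \subset S :\: U /\ #|R| = r.
    apply: (@subset_of_card _ (S :\: U) r); rewrite cardsD cS; apply: leq_sub2l.
    by apply: leq_trans cU; apply/subset_leq_card/subsetIr.
  have RI (j : 'I_k) v : v \in R -> v \notin I j.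
    move=> /(subsetP RSU); rewrite inE => /andP[vU _]; apply: contra vU => vI.
    by apply/bigcupP; exists j.
  apply/bigcupP; exists (R, [ffun j : 'I_k => I j]).
    rewrite inE /= cR eqxx /=; apply/and3P; split.
    - by apply/ffun_onP => j; rewrite ffunE inE; apply: ltnW; case: (I1 j).
    - apply/forallP => j; rewrite ffunE; apply/pred0P => v /=; apply/negP => /andP[vR].
      by apply/negP/RI.
    apply/forallP => i; apply/forallP => j; rewrite !ffunE; apply/implyP => ij.
    case: (ltngtP i j) => h; first by apply: I2; rewrite h /=.
      by rewrite disjoint_sym; apply: I2; rewrite h /=.
    by rewrite (val_inj h) eqxx in ij.
  rewrite inE; apply/allP => B /mapP[[v j]]; rewrite mem_enum inE /= => /andP[vR _] ->.
  have vS : v \in S by have := subsetP RSU v vR; rewrite inE => /andP[].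
  have /exists_inP[u uI] := I3 v vS (fun i ik => RI (Ordinal ik) v vR) j (ltn_ord j).
  move=> /andP[_ wvu]; apply/exists_inP; exists [set v; u] => //.
  by apply: imset_f; rewrite ffunE.
apply: Rle_trans (Pr_bigcup PE) _; apply: Rmult_le_compat_r => //.
have iM := inv_INR_bounds m.
apply: pow_le; have : ((1 - / INR m.+1) ^ t <= 1 ^ t)%R by apply: pow_incr; lra.
by rewrite pow1; lra.
Qed.

(** * Case (a) *)

(** The bad events have total probability below [1/3 + 2/3]. Outside them [alpha < r <= X + 1], and
    integrality gives [alpha <= X]. *)
Lemma good_graph (n s t m r : nat) (X : R) :
  (INR r <= X + 1)%R ->
  (Pr [set w : {ffun {set 'I_n} -> 'I_m.+1} | (r <= alpha (gedge w))%N] <= / 3)%R ->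
  (Pr [set w : {ffun {set 'I_n} -> 'I_m.+1} |
        [exists S : {set 'I_n}, (#|S| == s) && no_independent (gedge w) t S]] < 2 / 3)%R ->
  exists e : rel 'I_n, simple_graph e /\ (INR (alpha e) <= X)%R /\
    (forall S : {set 'I_n}, #|S| = s ->
       exists T : {set 'I_n}, T \subset S /\ #|T| = t /\ independent e T).
Proof.
move=> rX; set A := [set w | _ <= _] => hA; set B := [set w | _] => hB.
have [w] : exists w, w \notin A :|: B.
  apply: Pr_lt1_exists; apply: Rle_lt_trans (Pr_setU _ _) _.
  by apply: Rlt_le_trans (Rplus_le_lt_compat _ _ _ _ hA hB) _; lra.
rewrite !inE negb_or -ltnNge => /andP[/INR_leq]; rewrite S_INR => ar /existsPn hS.
exists (gedge w); split; first exact: gedge_simple.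
split; first lra.
move=> S cS; have := hS S; rewrite cS eqxx /= => /forallPn[T].
by rewrite negb_imply negbK => /andP[/andP[TS /eqP cT] iT]; exists T.
Qed.

Lemma ratio_facts (s t : nat) :
  (0 < t)%N -> (t < s)%N -> (INR s <= exp (2 * INR t))%R ->
  (0 < ln (INR s / INR t) <= 2 * INR t)%R /\
  (INR s = INR t * exp (ln (INR s / INR t)))%R.
Proof.
move=> t0 ts st.
have t0' := INR_gt0 t0; have ts' := INR_ltn ts; have t1 := INR_ge1 t0.
have lt0 : (0 <= ln (INR t))%R by rewrite -ln_1; apply: ln_leq; lra.
have s0 : (0 < INR s)%R by lra.
split; last first.
  by rewrite exp_ln; [field; lra | apply: Rdiv_lt_0_compat].
rewrite ln_div //; have := ln_increasing _ _ t0' ts'.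
by have := ln_leq s0 st; rewrite ln_exp; lra.
Qed.

Lemma theorem2p4_a (delta : R) : (0 < delta)%R ->
  exists C : R, (0 < C)%R /\ exists N : nat, forall n s t : nat,
    (N <= n)%N -> (0 < t)%N -> (t < s)%N -> (2 * s <= n)%N ->
    (INR s <= exp (2 * INR t))%R ->
    (Rpower (INR s / INR t) (1 - delta) >= ln (INR n))%R ->
    exists e : rel 'I_n, simple_graph e /\
      (INR (alpha e) <= C * (INR t / ln (INR s / INR t)) * ln (INR n / INR t))%R /\
      (forall S : {set 'I_n}, #|S| = s ->
         exists T : {set 'I_n}, T \subset S /\ #|T| = t /\ independent e T).
Proof.
(* The edge probability [p] will be about [L / (K t)]: the term [4 / delta] makes [(1 - p)^t] at
   least [exp (-(delta/2) L)], and the term [4] makes [p] at most [1/2]. *)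
move=> d0; pose K := (4 / delta + 4)%R.
have K0 : (0 < 4 / delta)%R by apply: Rdiv_lt_0_compat; lra.
have [N hN] := ln_INR_large (4 + exp (2 / delta * ln 24)).
exists (9 + 4 * (K + 2))%R; split; first by rewrite /K; lra.
exists N => n s t /hN[n0 ln_n] t0 ts sn st hyp.
have [[L0 L2] sE] := ratio_facts t0 ts st.
have t0' := INR_gt0 t0; have ts' := INR_ltn ts; have t1 := INR_ge1 t0.
have e24 := exp_pos (2 / delta * ln 24).
move: L0 L2 sE hyp; rewrite /Rpower; set L := ln (INR s / INR t) => L0 L2 sE hyp.
move: (ln_n); set l := ln (INR n) => ln_n'.
have l0 : (0 < l)%R by rewrite /l; lra.
have lnl : (2 / delta * ln 24 <= ln l)%R.
  by rewrite -(ln_exp (2 / delta * ln 24)); apply: ln_leq => //; rewrite /l; lra.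
have Ll : (ln l <= (1 - delta) * L)%R.
  by rewrite -(ln_exp ((1 - delta) * L)); apply: ln_leq; rewrite // /l; lra.
have LL : (ln l <= L)%R by nra.
have l_le : (l <= exp L)%R by rewrite -(exp_ln l) //; apply: exp_leq.
have x0 : (0 <= K * (INR t / L))%R.
  by apply/Rlt_le/Rmult_lt_0_compat; [rewrite /K; lra | apply: Rdiv_lt_0_compat].
have tL : (/ 2 <= INR t / L)%R.
  by apply: (Rmult_le_reg_r L) => //; rewrite /Rdiv Rmult_assoc Rinv_l; lra.
have K4 : (4 < K)%R by rewrite /K; lra.
have [M [M1 M2]] := nat_above x0.
have M3 : (2 < INR M)%R by nra.
case: M M1 M2 M3 => [|m] M1 M2 M3; first by rewrite /= in M3; lra.
have KtL : (K * (INR t / L) * L = K * INR t)%R by field; lra.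
(* [m + 1 <= K t/L + 1 <= (K + 2) t/L], since [t/L >= 1/2]. *)
have [|||r [rX Pr1]] := @Pr_alpha_le (9 + 4 * (K + 2)) (/ (K + 2)) n s t m _ _ t0 ts sn st.
- by lra.
- by rewrite Rmult_plus_distr_r Rmult_assoc Rinv_r; [have := Rinv_0_lt_compat (K + 2); lra | lra].
- apply: (Rmult_le_reg_l (K + 2)); first lra.
  rewrite -/L -!Rmult_assoc Rinv_r; last lra.
  have := Rmult_le_compat_r L _ _ (Rlt_le _ _ L0) M2; lra.
apply: (good_graph rX Pr1).
suff : (Pr [set w : {ffun {set 'I_n} -> 'I_m.+1} |
        [exists S : {set 'I_n}, (#|S| == s) && no_independent (gedge w) t S]] <= / 3)%R.
  by move=> h; apply: Rle_lt_trans h _; lra.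
(* The greedy sets then take at most half of [S]. *)
pose k := s %/ (2 * t).
have ks : 2 * (k * t) <= s by rewrite mulnCA; apply: leq_divM.
have kts : k * t <= s by apply: leq_trans ks; rewrite leq_pmull.
apply: Rle_trans (Pr_no_independent n m kts) _.
set q := ((1 - / INR m.+1) ^ t)%R.
have iM : (0 <= / INR m.+1 <= / 2)%R.
  split; first by apply/Rlt_le/Rinv_0_lt_compat; lra.
  by apply: Rinv_le_contravar; lra.
have q_lo : (exp (- (delta / 2 * L)) <= q)%R.
  apply: Rle_trans (exp_le_pow_1_minus t iM); apply: exp_leq.
  apply: Ropp_le_contravar.
  apply: (Rmult_le_reg_r (INR m.+1)); first lra.
  have -> : (2 * / INR m.+1 * INR t * INR m.+1 = 2 * INR t)%R by field; lra.
  have h : (K * INR t <= INR m.+1 * L)%R.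
    by rewrite -KtL; apply: Rmult_le_compat_r; lra.
  have : (4 / delta * INR t <= INR m.+1 * L)%R.
    by apply: Rle_trans h; apply: Rmult_le_compat_r; rewrite /K; lra.
  move=> h4; have := Rmult_le_compat_l (delta / 2) _ _ ltac:(lra) h4.
  have -> : (delta / 2 * (4 / delta * INR t) = 2 * INR t)%R by field; lra.
  lra.
have q_hi : (q <= 1)%R.
  by rewrite /q -[X in (_ <= X)%R](pow1 t); apply: pow_incr; lra.
have q0 : (0 <= q)%R by have := exp_pos (- (delta / 2 * L)); lra.
have n0' := INR_gt0 n0.
have n2 : (2 <= INR n)%R by have := INR_leq sn; rewrite INR_muln [INR 2]/=; lra.
have pn : (INR n.+1 ^ s <= exp (2 * l * INR s))%R.
  rewrite pow_exp_ln; last exact: INR_gt0.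
  apply: exp_leq; rewrite Rmult_comm; apply: Rmult_le_compat_r; first exact: pos_INR.
  have -> : (2 * l = ln (INR n * INR n))%R by rewrite ln_mult // /l; lra.
  by apply: ln_leq; [exact: INR_gt0 | rewrite S_INR; nra].
apply: Rle_trans (_ : _ <= exp (2 * l * INR s) * exp (- (q * INR ((s - k * t) * k))))%R _.
  apply: Rmult_le_compat => //; last by apply: pow_1_minus_le_exp; lra.
    by apply: pow_le; apply: pos_INR.
  by apply: pow_le; lra.
rewrite -exp_plus; apply: Rle_trans (Rlt_le _ _ inv_exp2_lt); rewrite -exp_Ropp; apply: exp_leq.
have r_lo : (INR s / 2 <= INR (s - k * t))%R.
  by rewrite INR_subn //; have := INR_leq ks; rewrite INR_muln [INR 2]/=; lra.
have k_lo : (exp L / 4 <= INR k)%R.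
  apply: (Rmult_le_reg_r (INR t)) => //.
  have : s < k.+1 * (2 * t) by apply: ltn_ceil; lia.
  move=> /INR_ltn; rewrite !INR_muln S_INR [INR 2]/= {1}sE; nra.
have e1 : (24 <= exp (delta / 2 * L))%R.
  rewrite -(exp_ln 24); last lra.
  apply: exp_leq; have := Rmult_le_compat_l (delta / 2) _ _ ltac:(lra) lnl.
  have -> : (delta / 2 * (2 / delta * ln 24) = ln 24)%R by field; lra.
  by have := Rmult_le_compat_l (delta / 2) _ _ ltac:(lra) LL; lra.
have e2 : (exp (- (delta / 2 * L)) * exp L = exp ((1 - delta) * L) * exp (delta / 2 * L))%R.
  by rewrite -!exp_plus; congr exp; lra.
(* The exponent is at least [q (s/2) (exp L / 4)], so the factor 24 yields [3 l s], against the
   [2 l s] spent on certificates. *)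
have e3 : (24 * l <= q * exp L)%R.
  apply: Rle_trans (_ : _ <= exp (- (delta / 2 * L)) * exp L)%R _; last first.
    by apply: Rmult_le_compat_r => //; apply/Rlt_le/exp_pos.
  rewrite e2 Rmult_comm; apply: Rmult_le_compat; rewrite -/l in hyp; lra.
have : (3 * l * INR s <= q * INR ((s - k * t) * k))%R.
  rewrite INR_muln; apply: Rle_trans (_ : _ <= q * (INR s / 2 * (exp L / 4)))%R _.
    have := Rmult_le_compat_r (INR s) _ _ (pos_INR s) e3; lra.
  apply: Rmult_le_compat_l => //; apply: Rmult_le_compat => //.
    by have := pos_INR s; lra.
  by have := exp_pos L; lra.
have : (4 <= l * INR s)%R.
  have s1 : (1 <= INR s)%R by lra.
  by rewrite -/l in ln_n; nra.
by lra.
Qed.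

(** * Independent sets in triangle-free graphs *)

(** Complementation inside [X] pairs [Y] with [X :\: Y], so the average size is half of [#|X|]. *)
Lemma sum_card_powerset (T : finType) (X : {set T}) :
  2 * (\sum_(Y : {set T} | Y \subset X) #|Y|) = #|X| * 2 ^ #|X|.
Proof.
have e : \sum_(Y : {set T} | Y \subset X) #|Y| =
         \sum_(Y : {set T} | Y \subset X) (#|X| - #|Y|).
  rewrite (reindex_onto (fun Y => X :\: Y) (fun Y => X :\: Y)); last first.
    by move=> Y YX; rewrite setDDr setDv set0U; apply/setIidPr.
  apply: eq_big => [Y|Y /andP[_ /eqP YX]].
    rewrite subsetDl setDDr setDv set0U /=; apply/eqP/idP; last by move/setIidPr.
    by move=> <-; apply: subsetIl.
  by rewrite cardsD (setIidPr _) // -YX subsetDl.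
rewrite mul2n -addnn {1}e -big_split /=.
under eq_bigr => Y YX do rewrite subnK ?subset_leq_card //.
rewrite sum_nat_const mulnC; congr muln.
by rewrite -card_powerset; apply: eq_card => Y; rewrite !inE.
Qed.

(** The inequality needed on one fibre of [2^x + 1] independent sets. If [x >= 4 b], the term
    [x * 2^x] suffices; otherwise [2^x <= 16^b] and [2 b <= 2^b], hence the base 32. *)
Lemma lens_arith (b x : nat) : 2 * (b * (2 ^ x + 1)) <= 2 * 32 ^ b + x * 2 ^ x.
Proof.
have p x' : 0 < 2 ^ x' by rewrite expn_gt0.
have h x' : x' < 2 ^ x' by apply: ltn_expl.
case: (leqP (4 * b) x) => hx.
  have : 4 * b * 2 ^ x <= x * 2 ^ x by rewrite leq_mul2r hx orbT.
  have := p x; have := p b; nia.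
case: b hx => [|b] hx; first by rewrite mul0n muln0.
have e : 2 ^ x <= 16 ^ b.+1.
  by rewrite (_ : 16 = 2 ^ 4) // -expnM leq_exp2l // ltnW.
have e2 : 32 ^ b.+1 = 2 ^ b.+1 * 16 ^ b.+1 by rewrite -expnMn.
have e3 : 2 * b.+1 <= 2 ^ b.+1.
  by rewrite expnS leq_mul2l /=; apply: h.
have e4 : 2 * b.+1 * 16 ^ b.+1 <= 2 ^ b.+1 * 16 ^ b.+1 by rewrite leq_mul2r e3 orbT.
have e5 := p x.
rewrite e2; nia.
Qed.

(* Conditioning on the part of a random independent set outside the closed
   neighbourhood of [v], the part inside is either [v] alone or an arbitrary
   subset of the still available neighbours of [v]. *)
Lemma independent_fiber_sum (n : nat) (e : rel 'I_n) (U : {set 'I_n}) (v : 'I_n)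
    (W0 : {set 'I_n}) (F : {set 'I_n} -> nat) :
  simple_graph e ->
  (forall x y z, x \in U -> y \in U -> z \in U -> e x y -> e y z -> e x z -> False) ->
  v \in U -> W0 \subset U -> independent e W0 ->
  let N := [set u in U | e v u] in
  let Z := W0 :\: (v |: N) in
  let X := [set u in N | [forall z in Z, ~~ e u z]] in
  \sum_(W : {set 'I_n} | (W \subset U) && independent e W && (W :\: (v |: N) == Z)) F W
    = F (v |: Z) + \sum_(Y : {set 'I_n} | Y \subset X) F (Z :|: Y).
Proof.
move=> [esym eirr] tri vU W0U iW0 N Z X.
have ZU : Z \subset U by apply: subset_trans W0U; apply: subsetDl.
have iZ : independent e Z by apply: independent_subset iW0; apply: subsetDl.
have ZN z : z \in Z -> z != v /\ z \notin N.
  by rewrite !inE negb_or => /andP[/andP[-> ->]].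
have NU : N \subset U by apply/subsetP => u; rewrite inE => /andP[].
have vN : v \notin N by rewrite inE eirr andbF.
have vZ : v \notin Z by rewrite !inE eqxx.
have noE (W : {set 'I_n}) x y : independent e W -> x \in W -> y \in W -> ~~ e x y.
  by move=> /forall_inP h /h /forall_inP; apply.
(* An independent [W] containing [v] contains no neighbour of [v], so it is [v |: Z]. *)
rewrite (bigID (fun W : {set 'I_n} => v \in W)) /=; congr addn.
  rewrite (eq_bigl (pred1 (v |: Z))) ?big_pred1_eq // => W /=.
  apply/andP/eqP => [[/andP[/andP[WU iW] /eqP WZ] vW]|->].
    rewrite -WZ; apply/setP => x; rewrite in_setU1 in_setD in_setU1.
    case: eqVneq => [->|xv] /=; first by rewrite vW.
    case xW: (x \in W); last by rewrite andbF.
    have nvx := noE W v x iW vW xW.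
    by rewrite inE (negbTE nvx) andbF.
  rewrite setU11; split=> //; apply/andP; split.
    rewrite subUset sub1set vU ZU /=.
    apply/forall_inP => x; rewrite in_setU1 => xW; apply/forall_inP => y.
    rewrite in_setU1; case/orP: xW => [/eqP->|xZ] /orP[/eqP->|yZ].
    - by rewrite eirr.
    - have [_] := ZN y yZ; rewrite inE => h; apply: contra h => ->.
      by rewrite (subsetP ZU).
    - have [_] := ZN x xZ; rewrite inE esym => h; apply: contra h => ->.
      by rewrite (subsetP ZU).
    - exact: noE iZ xZ yZ.
  apply/eqP/setP => x; rewrite in_setD in_setU1 in_setU1.
  case: eqVneq => [->|xv] /=; first by rewrite (negbTE vZ).
  by case xZ: (x \in Z); rewrite ?andbF ?andbT //; have [_ ->] := ZN x xZ.
(* A [W] without [v] is recovered from [Y = W :&: N]. *)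
rewrite (reindex_onto (fun Y => Z :|: Y) (fun W => W :&: N)) /=; last first.
  move=> W /andP[/andP[_ /eqP WZ] vW]; rewrite -WZ.
  apply/setP => x; rewrite in_setU in_setD in_setU1 in_setI.
  case: eqVneq => [->|xv] /=; first by rewrite (negbTE vW).
  by case: (x \in W); case: (x \in N).
apply: eq_bigl => Y; apply/idP/idP.
  move=> /andP[/andP[/andP[/andP[WU iW] WZ] vW] /eqP eY].
  apply/subsetP => u uY; have uN : u \in N.
    by have /setP/(_ u) := eY; rewrite in_setI in_setU uY orbT.
  rewrite inE uN /=; apply/forall_inP => z zZ.
  by apply: noE iW _ _; rewrite in_setU ?uY ?zZ ?orbT.
move=> /subsetP YX.
have YN u : u \in Y -> u \in N by move=> /YX; rewrite inE => /andP[].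
have YZ u z : u \in Y -> z \in Z -> ~~ e u z.
  by move=> /YX; rewrite inE => /andP[_ /forall_inP]; apply.
rewrite -!andbA; apply/and5P; split.
- by rewrite subUset ZU; apply/subsetP => u /YN /(subsetP NU).
- apply/forall_inP => x; rewrite in_setU => xW; apply/forall_inP => y.
  rewrite in_setU; case/orP: xW => xW /orP[] yW.
  + exact: noE iZ xW yW.
  + by rewrite esym YZ.
  + by rewrite YZ.
  (* Adjacent [x] and [y] in [N] would form a triangle with [v]. *)
  have := YN x xW; have := YN y yW; rewrite !inE => /andP[yU vy] /andP[xU vx].
  by apply/negP => exy; apply: (tri v x y).
- apply/eqP/setP => x; rewrite in_setD in_setU1 in_setU.
  case: eqVneq => [->|xv] /=; first by rewrite (negbTE vZ).
  case xZ: (x \in Z) => /=; first by have [_ ->] := ZN x xZ.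
  by case xY: (x \in Y); rewrite ?andbF //; rewrite (YN x xY).
- rewrite in_setU (negbTE vZ) /=; apply: contra vN; exact: YN.
- apply/eqP/setP => x; rewrite in_setI in_setU.
  case xZ: (x \in Z) => /=; last by case xY: (x \in Y) => //=; exact: YN.
  have [_ xN] := ZN x xZ; rewrite (negbTE xN); case xY: (x \in Y) => //.
  by rewrite (YN x xY) in xN.
Qed.

(** Group the sets [W] by their part outside [v] and its neighbours. If [x] neighbours remain
    available, the set with [v] contributes at least [32^b], the [2^x] others together at least
    [x * 2^x / 2], and [lens_arith] applies. *)
Lemma local_occupancy (n b : nat) (e : rel 'I_n) (U : {set 'I_n}) (v : 'I_n) :
  simple_graph e ->
  (forall x y z, x \in U -> y \in U -> z \in U -> e x y -> e y z -> e x z -> False) ->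
  v \in U ->
  \sum_(W : {set 'I_n} | (W \subset U) && independent e W) b <=
  \sum_(W : {set 'I_n} | (W \subset U) && independent e W)
     (32 ^ b * (v \in W) + #|[set u in W | e v u]|).
Proof.
move=> sg tri vU; pose N := [set u in U | e v u].
rewrite (partition_big (fun W : {set 'I_n} => W :\: (v |: N)) xpredT) //=.
rewrite [X in _ <= X](partition_big (fun W : {set 'I_n} => W :\: (v |: N)) xpredT) //=.
apply: leq_sum => Z _.
case: (pickP (fun W : {set 'I_n} =>
    (W \subset U) && independent e W && (W :\: (v |: N) == Z))) => [W0|none]; last first.
  by rewrite big_pred0.
move=> /andP[/andP[W0U iW0] /eqP eZ]; subst Z.
rewrite !(independent_fiber_sum _ sg tri vU W0U iW0).
set X := [set u in _ | _]; rewrite -/N; set Z := W0 :\: _.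
rewrite sum_nat_const (eq_card (_ : _ =i powerset X)); last by move=> Y; rewrite !inE.
rewrite card_powerset setU11 muln1.
have hY : \sum_(Y : {set 'I_n} | Y \subset X) #|Y| <=
   \sum_(Y : {set 'I_n} | Y \subset X)
      (32 ^ b * (v \in Z :|: Y) + #|[set u in Z :|: Y | e v u]|).
  apply: leq_sum => Y /subsetP YX; apply: leq_trans (leq_addl _ _).
  apply/subset_leq_card/subsetP => u uY; rewrite !inE uY orbT /=.
  by have := YX u uY; rewrite !inE => /andP[/andP[_ ->]].
have := lens_arith b #|X|; have := sum_card_powerset X.
move: hY; set A := \sum_(_ | _) _; set B := \sum_(_ | _) _.
move: (#|X|) (2 ^ #|X|) => x p; nia.
Qed.

(* Shearer's bound by counting (Alon-Spencer): double counting over all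
   independent sets [W] the weights
   [32 ^ b * (v \in W) + #|N(v) :&: W|], whose average is at least [b] at each [v]. *)
Lemma triangle_free_independent (n b : nat) (e : rel 'I_n) (U : {set 'I_n}) :
  simple_graph e ->
  (forall x y z, x \in U -> y \in U -> z \in U -> e x y -> e y z -> e x z -> False) ->
  (forall v, v \in U -> #|[set u in U | e v u]| <= 32 ^ b) ->
  exists A : {set 'I_n}, [/\ A \subset U, independent e A & #|U| * b <= 2 * 32 ^ b * #|A|].
Proof.
move=> sg tri deg.
pose P (W : {set 'I_n}) := (W \subset U) && independent e W.
pose g v (W : {set 'I_n}) := 32 ^ b * (v \in W) + #|[set u in W | e v u]|.
have h1 : \sum_(W | P W) #|U| * b <= \sum_(W | P W) \sum_(v in U) g v W.
  rewrite exchange_big /=.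
  under eq_bigr => W _ do rewrite -sum_nat_const.
  rewrite exchange_big /=; apply: leq_sum => v vU; exact: local_occupancy.
(* A vertex of [W] accounts for [32^b] in the first term and, once per neighbour in [U], for at most
   [32^b] in the second. *)
have h2 W : P W -> \sum_(v in U) g v W <= 2 * 32 ^ b * #|W|.
  move=> /andP[/subsetP WU _]; rewrite big_split /= -big_distrr /= mul2n -addnn mulnDl.
  apply: leq_add.
    rewrite leq_mul2l; apply/orP; right.
    rewrite -sum1_card big_mkcond /= [X in _ <= X]big_mkcond /=.
    by apply: leq_sum => v _; case: (v \in U); case: (v \in W).
  under eq_bigr => v _ do rewrite -sum1_card.
  under eq_bigr => v _ do under eq_bigl => u do rewrite inE.
  rewrite (exchange_big_dep (mem W)) /=; last by move=> v u _ /andP[].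
  rewrite mulnC -sum_nat_const; apply: leq_sum => u uW.
  rewrite sum1_card; apply: leq_trans (deg u (WU u uW)).
  apply/subset_leq_card/subsetP => v; rewrite !inE => /andP[-> /andP[_]].
  by case: sg => -> _ ->.
case: (boolP [exists W, P W && (#|U| * b <= 2 * 32 ^ b * #|W|)]).
  by move=> /existsP[W /andP[/andP[WU iW] hW]]; exists W.
move=> /existsPn none.
have : \sum_(W | P W) \sum_(v in U) g v W < \sum_(W | P W) #|U| * b; last by rewrite ltnNge h1.
have P0 : P set0 by rewrite /P sub0set; apply/forall_inP => x; rewrite inE.
have lt W : P W -> \sum_(v in U) g v W < #|U| * b.
  move=> PW; apply: leq_ltn_trans (h2 W PW) _.
  by have := none W; rewrite PW /= -ltnNge.
(* If every [W] fails, all terms compare strictly, and [set0] guarantees that there is a term. *)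
rewrite (bigD1 set0) //= [X in _ < X](bigD1 set0) //= -addSn; apply: leq_add; first exact: lt.
by apply: leq_sum => W /andP[PW _]; apply: ltnW; apply: lt.
Qed.

(** * Independent sets in graphs with few edge-disjoint triangles *)

(* Any partition minimising the total monochromatic weight works. *)
Lemma balanced_partition (T : finType) (w : T -> T -> nat) (K : nat) :
  (forall u v, w u v = w v u) -> (forall v, w v v = 0) -> 0 < K ->
  exists f : T -> 'I_K, forall v, K * (\sum_(u | f u == f v) w v u) <= \sum_u w v u.
Proof.
move=> wC w0 K0.
pose Phi (f : {ffun T -> 'I_K}) := \sum_x \sum_(y | f y == f x) w x y.
pose own (f : {ffun T -> 'I_K}) v c := \sum_(u | (u != v) && (f u == c)) w v u.
(* [Phi] counts each monochromatic pair twice; only the last summand depends on the class of [v]. *)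
have PhiE v f : Phi f = \sum_(x | x != v) \sum_(y | (y != v) && (f y == f x)) w x y
                        + 2 * own f v (f v).
  rewrite /Phi (bigD1 v) //= addnC.
  have ownE : \sum_(y | f y == f v) w v y = own f v (f v).
    by rewrite (bigD1 v) //= w0 add0n; apply: eq_bigl => y; rewrite andbC.
  have split_v x : x != v -> \sum_(y | f y == f x) w x y
      = \sum_(y | (y != v) && (f y == f x)) w x y + (if f x == f v then w v x else 0).
    move=> xv; rewrite [in LHS](bigID (pred1 v)) /= addnC; congr addn.
      by apply: eq_bigl => y; rewrite andbC.
    case: eqP => fx; last by rewrite big1 // => y /andP[/eqP fy /eqP yv]; subst y; case: fx.
    rewrite (eq_bigl (pred1 v)) ?big_pred1_eq // => y /=.
    by case: (eqVneq y v) => [->|]; rewrite ?andbF // fx eqxx.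
  rewrite (eq_bigr _ split_v) big_split /= -addnA ownE; congr addn.
  rewrite mul2n -addnn; congr addn.
  by rewrite /own [RHS]big_mkcondr.
have [f _ fmin] := @arg_minnP _ [ffun _ : T => Ordinal K0] xpredT Phi isT.
exists f => v.
(* Moving [v] to class [c] cannot lower the minimal [Phi]. The own class is thus the lightest and
   has at most the average weight. *)
have own_le c : own f v (f v) <= own f v c.
  pose g := [ffun x => if x == v then c else f x].
  have gv : g v = c by rewrite ffunE eqxx.
  have gx x : x != v -> g x = f x by move=> xv; rewrite ffunE (negbTE xv).
  have := fmin g isT; rewrite !(PhiE v) gv.
  have -> : own g v c = own f v c.
    by apply: eq_bigl => u; case uv: (u != v) => //=; rewrite gx.
  have -> : \sum_(x | x != v) \sum_(y | (y != v) && (g y == g x)) w x y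
          = \sum_(x | x != v) \sum_(y | (y != v) && (f y == f x)) w x y.
    apply: eq_bigr => x xv; apply: eq_bigl => y; case yv: (y != v) => //=.
    by rewrite !gx.
  by rewrite leq_add2l leq_mul2l.
have -> : \sum_(u | f u == f v) w v u = own f v (f v).
  by rewrite (bigD1 v) //= w0 add0n; apply: eq_bigl => y; rewrite andbC.
rewrite -[X in X * _](card_ord K) -sum_nat_const.
apply: leq_trans (_ : \sum_(c : 'I_K) own f v c <= _); first exact: leq_sum.
rewrite [X in _ <= X](bigD1 v) //= w0 add0n.
by rewrite [X in _ <= X](partition_big f xpredT) //=.
Qed.

Definition cliques (n : nat) (e : rel 'I_n) (S : {set 'I_n}) (j : nat) : {set {set 'I_n}} :=
  [set A : {set 'I_n} | [&& A \subset S, #|A| == j &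
     [forall x in A, forall y in A, (x != y) ==> e x y]]].

Definition edge_disjoint (n : nat) (F : {set {set 'I_n}}) : bool :=
  [forall A in F, forall B in F, (A != B) ==> (#|A :&: B| <= 1)].

(** Handshake count: [y] goes to the edge [{x, y}] injectively, and an edge has two ends. *)
Lemma sum_degree (n : nat) (e : rel 'I_n) (S : {set 'I_n}) :
  simple_graph e ->
  \sum_(x in S) \sum_(y in S) e x y <= 2 * #|cliques e S 2|.
Proof.
move=> [esym eirr].
have h x : x \in S -> \sum_(y in S) e x y <= \sum_(A in cliques e S 2) (x \in A).
  move=> xS.
  rewrite !sum_nat_bool.
  rewrite -(@card_in_imset _ _ (fun y => [set x; y])); last first.
    move=> y z; rewrite !inE => /andP[_ xy] /andP[_ xz] eyz.
    have : y \in [set x; z] by rewrite -eyz !inE eqxx orbT.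
    by rewrite !inE => /orP[/eqP yx|/eqP //]; rewrite yx eirr in xy.
  apply/subset_leq_card/subsetP => A /imsetP[y]; rewrite inE => /andP[yS xy] ->.
  have xny : x != y by apply: contraTneq xy => ->; rewrite eirr.
  rewrite !inE eqxx /= andbT subUset !sub1set xS yS cards2 xny /=.
  apply/forall_inP => a; rewrite !inE => /orP[]/eqP->; apply/forall_inP => c;
    rewrite !inE => /orP[]/eqP->; rewrite ?eqxx //; apply/implyP => _ //.
  by rewrite esym.
apply: leq_trans (leq_sum _ h) _.
rewrite exchange_big /= mulnC -sum_nat_const; apply: leq_sum => A.
rewrite inE => /and3P[AS /eqP <- _].
rewrite -sum1_card [X in _ <= X]big_mkcond /= [X in X <= _]big_mkcond /=.
by apply: leq_sum => x _; case: (x \in S).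
Qed.

(** A family of largest size works: a triangle meeting each member in at most one vertex could be
    added to it. *)
Lemma maximal_packing (n : nat) (e : rel 'I_n) (S : {set 'I_n}) :
  exists F : {set {set 'I_n}}, [/\ F \subset cliques e S 3, edge_disjoint F &
    forall A, A \in cliques e S 3 -> exists2 B, B \in F & 1 < #|A :&: B|].
Proof.
pose P (F : {set {set 'I_n}}) := (F \subset cliques e S 3) && edge_disjoint F.
have P0 : P set0 by rewrite /P sub0set; apply/forall_inP => x; rewrite inE.
case: (@arg_maxnP _ set0 P (fun F : {set {set 'I_n}} => #|F|) P0) => F /andP[FS dF] Fmax.
exists F; split=> // A AT; case: (boolP (A \in F)) => [AF|AF].
  by exists A => //; rewrite setIid; move: AT; rewrite inE => /and3P[_ /eqP -> _].
case: (boolP [exists B in F, 1 < #|A :&: B|]) => [/exists_inP[B BF hB]|/exists_inPn none].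
  by exists B.
have : P (A |: F).
  rewrite /P subUset sub1set AT FS /=; apply/forall_inP => B; rewrite in_setU1 => BF.
  apply/forall_inP => C; rewrite in_setU1; apply: contraTT => /=.
  rewrite negb_imply -ltnNge => /andP[BC hBC].
  case/orP: BF => [/eqP eB|BF]; subst.
    rewrite negb_or eq_sym BC /=; apply/negP => CF; have := none C CF.
    by rewrite hBC.
  rewrite negb_or; apply/andP; split.
    by apply/eqP => eC; subst; have := none B BF; rewrite setIC hBC.
  apply/negP => CF; have := forall_inP (forall_inP dF B BF) C CF.
  by rewrite BC /= leqNgt hBC.
by move=> /Fmax /=; rewrite cardsU1 AF add1n ltnn.
Qed.

(* If [F] is a maximal edge-disjoint family of triangles, a set of vertices
   spanning no pair covered by a member of [F] is triangle-free. *)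
Lemma sparse_has_independent (n b t B E k : nat) (e : rel 'I_n) (S : {set 'I_n}) :
  simple_graph e ->
  #|cliques e S 2| <= E ->
  (forall F : {set {set 'I_n}}, F \subset cliques e S 3 -> edge_disjoint F -> #|F| <= k) ->
  2 * (2 * E + 9 * ((32 ^ b).+1 * k)) < #|S| * B.+1 ->
  4 * t * (B + 32 ^ b) <= #|S| * b ->
  ~~ no_independent e t S.
Proof.
move=> sg hE hk hB ht; apply/negP => noS; have [esym eirr] := sg.
have [F [FS dF Fmax]] := maximal_packing e S.
set D := 32 ^ b in hB ht *; have D0 : 0 < D by rewrite expn_gt0.
pose fe (u v : 'I_n) := (u != v) && [exists A in F, (u \in A) && (v \in A)].
have feC u v : fe u v = fe v u.
  by rewrite /fe eq_sym; under eq_existsb => A do rewrite [(u \in A) && _]andbC.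
(* One covered pair outweighs [D], the monochromatic weight that each vertex will be allowed. *)
pose w0 (u v : 'I_n) : nat := e u v + D.+1 * fe u v.
pose V := [set v in S | \sum_(u in S) w0 v u <= B].
have VS : V \subset S by apply/subsetP => v; rewrite inE => /andP[].
(* Nine bounds the ordered pairs from one triangle, repetitions included. *)
have sumfe : \sum_(v in S) \sum_(u in S) fe v u <= 9 * #|F|.
  have le1 v : \sum_(u in S) fe v u <= \sum_(u in S) \sum_(A in F) ((v \in A) && (u \in A)).
    apply: leq_sum => u _; rewrite /fe; case: eqP => //= _.
    by case: exists_inP => //= -[A AF hA]; rewrite (bigD1 A) //= hA.
  apply: leq_trans (leq_sum _ (fun v _ => le1 v)) _.
  under eq_bigr => v _ do rewrite exchange_big /=.
  rewrite exchange_big /= mulnC -sum_nat_const; apply: leq_sum => A /(subsetP FS).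
  rewrite inE => /and3P[_ /eqP cA _].
  have s3 (c : bool) : \sum_(u in S) (c && (u \in A)) <= c * 3.
    rewrite -cA; case: c; last by rewrite big1.
    rewrite mul1n -sum1_card [X in _ <= X]big_mkcond /= [X in X <= _]big_mkcond /=.
    by apply: leq_sum => x _; case: (x \in S).
  apply: leq_trans (leq_sum _ (fun v _ => s3 (v \in A))) _.
  by rewrite -big_distrl /= (_ : 9 = 3 * 3) // leq_mul2r /= (s3 true).
have sumw : \sum_(v in S) \sum_(u in S) w0 v u <= 2 * E + 9 * (D.+1 * k).
  under eq_bigr => v _ do rewrite big_split /= -big_distrr /=.
  rewrite big_split /= -big_distrr /=; apply: leq_add.
    by apply: leq_trans (sum_degree S sg) _; rewrite leq_mul2l.
  rewrite mulnCA leq_mul2l /=; apply: leq_trans sumfe _.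
  by rewrite leq_mul2l /=; apply: hk.
(* Markov's inequality: a vertex outside [V] has weight above [B], and by [hB] fewer than half of
   [S] can. *)
have cV : #|S| <= 2 * #|V|.
  have : B.+1 * #|S :\: V| <= \sum_(v in S) \sum_(u in S) w0 v u.
    rewrite mulnC -sum_nat_const big_mkcond /= [X in _ <= X]big_mkcond /=.
    apply: leq_sum => v _; rewrite in_setD inE; case: (v \in S); rewrite ?andbF //=.
    by rewrite andbT -ltnNge; case: ltnP.
  rewrite cardsD (setIidPr VS) => h1; have := subset_leq_card VS; nia.
pose w u v := if (u \in V) && (v \in V) then w0 u v else 0.
(* With [K] classes, a weight of at most [B] averages below [D + 1], so the monochromatic weight at
   a vertex is at most [D]. *)
pose K := (B %/ D.+1).+1.
have BK : B < K * D.+1 by apply: ltn_ceil.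
have KD : K * D <= B + D.
  by rewrite mulSn addnC leq_add2r; apply: leq_trans (leq_divM B D.+1); rewrite leq_mul2l leqnSn orbT.
have [|v||f hf] := @balanced_partition _ w K.
- by move=> u v; rewrite /w /w0 andbC esym feC.
- by rewrite /w /w0 eirr /fe eqxx muln0; case: ifP.
- by [].
pose U c := [set v in V | f v == c].
have own v : v \in V -> \sum_(u in U (f v)) w0 v u <= D.
  move=> vV; have e1 : \sum_(u in U (f v)) w0 v u = \sum_(u | f u == f v) w v u.
    rewrite big_mkcond [RHS]big_mkcond; apply: eq_bigr => u _.
    by rewrite inE /w vV /=; case: (u \in V) => //=; case: eqP.
  have e2 : \sum_u w v u <= B.
    have : v \in V by []. rewrite inE => /andP[_]; apply: leq_trans.
    rewrite [X in _ <= X]big_mkcond; apply: leq_sum => u _; rewrite /w vV /=.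
    by case uV: (u \in V) => //; rewrite (subsetP VS).
  rewrite -ltnS -(ltn_pmul2l (ltn0Sn (B %/ D.+1))) e1.
  by apply: leq_ltn_trans (leq_trans (hf v) e2) BK.
have [c hc] : exists c, #|V| <= K * #|U c|.
  case: (boolP [exists c, #|V| <= K * #|U c|]) => [/existsP //|/existsPn none].
  have := none (Ordinal (ltn0Sn (B %/ D.+1))); rewrite -ltnNge => V0.
  have : #|V| = \sum_c #|U c|.
    rewrite -sum1_card (partition_big f xpredT) //=; apply: eq_bigr => c _.
    by rewrite sum1_card; apply: eq_card => v; rewrite !inE unfold_in /= !inE.
  have : \sum_(c : 'I_K) K * #|U c| <= \sum_(c : 'I_K) (#|V|).-1.
    by apply: leq_sum => c _; have := none c; rewrite -ltnNge; case: #|V|.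
  rewrite -big_distrr sum_nat_const card_ord /= leq_mul2l /= => h1 h2.
  by move: h1; rewrite -h2; case: #|V| V0 => //= a _; rewrite ltnn.
have U_sub v : v \in U c -> v \in V /\ f v = c by rewrite inE => /andP[? /eqP].
have nofe u v : u \in U c -> v \in U c -> fe u v = false.
  move=> uU vU; have [uV fu] := U_sub u uU; have := own u uV; rewrite fu (bigD1 v) //=.
  by rewrite /w0; case: (fe u v) => //; rewrite muln1; lia.
have [||A [AU iA cA]] := @triangle_free_independent n b e (U c) sg.
- move=> x y z xU yU zU xy yz xz.
  have xny : x != y by apply: contraTneq xy => ->; rewrite eirr.
  have ynz : y != z by apply: contraTneq yz => ->; rewrite eirr.
  have xnz : x != z by apply: contraTneq xz => ->; rewrite eirr.
  have US : {subset U c <= S} by move=> v /U_sub[/(subsetP VS)].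
  have : [set x; y; z] \in cliques e S 3.
    rewrite inE; apply/and3P; split.
    - by rewrite !subUset !sub1set !US.
    - by rewrite setUC cardsU1 !inE negb_or ![z == _]eq_sym xnz ynz cards2 xny.
    apply/forall_inP => p; rewrite !inE => /orP[/orP[]|]/eqP->; apply/forall_inP => q;
      rewrite !inE => /orP[/orP[]|]/eqP->; rewrite ?eqxx //; apply/implyP => _ //;
      by rewrite esym.
  (* A triangle inside the class shares two vertices with a member of [F], a covered pair that
     [nofe] excludes. *)
  move=> /Fmax[C CF /card_gt1P[p [q [pC qC pq]]]].
  have tU p' : p' \in [set x; y; z] :&: C -> p' \in U c /\ p' \in C.
    by rewrite in_setI => /andP[]; rewrite !in_setU !in_set1 => /orP[/orP[]|]/eqP-> ->.
  have [pU {}pC] := tU p pC; have [qU {}qC] := tU q qC.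
  have := nofe p q pU qU; rewrite /fe pq /=; case: exists_inP => // -[].
  by exists C => //; rewrite pC qC.
- move=> v vU; have [vV fv] := U_sub v vU; apply: leq_trans (own v vV).
  rewrite fv -sum_nat_bool; apply: leq_sum => u _.
  by rewrite /w0; case: (e v u).
have UV : U c \subset V by apply/subsetP => v /U_sub[].
have At := no_independent_card noS (subset_trans AU (subset_trans UV VS)) iA.
rewrite -/D in cA.
(* In all, [#|S| b <= 2 K #|U c| b <= 4 K D #|A| <= 4 (B + D) #|A| < 4 (B + D) t], against [ht]. *)
have h1 : #|S| * b <= 2 * #|V| * b by rewrite leq_mul2r cV orbT.
have h2 : 2 * #|V| * b <= 2 * (K * #|U c|) * b by rewrite leq_mul2r leq_mul2l hc !orbT.
have h3 : K * (#|U c| * b) <= K * (2 * D * #|A|) by rewrite leq_mul2l cA orbT.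
have h4 : K * D * #|A| <= (B + D) * #|A| by rewrite leq_mul2r KD orbT.
have h5 : (B + D) * #|A| < (B + D) * t by rewrite ltn_mul2l At andbT addn_gt0 D0 orbT.
nia.
Qed.

(** * Tail bounds for edges and edge-disjoint triangles *)

Lemma clique_pairs (n m j : nat) (w : {ffun {set 'I_n} -> 'I_m.+1}) (S A : {set 'I_n}) :
  A \in cliques (gedge w) S j -> forall x, x \in pairs A -> w x == ord0.
Proof.
rewrite inE => /and3P[_ _ /forall_inP cl] x; rewrite inE => /andP[/subsetP xA].
move=> /cards2P[u [v [uv ex]]].
have uA : u \in A by apply: xA; rewrite ex !inE eqxx.
have vA : v \in A by apply: xA; rewrite ex !inE eqxx orbT.
by have := forall_inP (cl u uA) v vA; rewrite uv /= ex => /andP[].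
Qed.

(** Edge-disjointness puts each pair into at most one member, and a triangle has three pairs. *)
Lemma card_bigcup_pairs (n : nat) (F : {set {set 'I_n}}) :
  (forall A, A \in F -> #|A| = 3) -> edge_disjoint F ->
  3 * #|F| <= #|\bigcup_(A in F) pairs A|.
Proof.
move=> F3 /forall_inP dF; set X := \bigcup_(A in F) pairs A.
have <- : \sum_(A in F) #|pairs A| = 3 * #|F|.
  rewrite mulnC -sum_nat_const; apply: eq_bigr => A AF.
  by rewrite card_pairs F3.
have e A : A \in F -> #|pairs A| = \sum_(x in X) (x \in pairs A).
  move=> AF; rewrite sum_nat_bool; apply: eq_card => x; rewrite [in RHS]inE.
  case xA: (x \in pairs A); last by rewrite andbF.
  by rewrite andbT; apply/esym/bigcupP; exists A.
rewrite (eq_bigr _ e) exchange_big /= -sum1_card; apply: leq_sum => x _.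
rewrite sum_nat_bool; rewrite leqNgt; apply/negP => /card_gt1P[A [B []]].
rewrite !inE => /andP[AF /andP[xA /eqP x2]] /andP[BF /andP[xB _]] AB.
have := forall_inP (dF A AF) B BF; rewrite AB /= leqNgt => /negP; apply.
by rewrite -x2; apply: subset_leq_card; rewrite subsetI xA.
Qed.

(** Union bound over the sets of [E] pairs in [S], each present with probability [(m + 1)^(-E)]. *)
Lemma Pr_edges_ge (n m E : nat) (S : {set 'I_n}) : 0 < E ->
  (Pr [set w : {ffun {set 'I_n} -> 'I_m.+1} | (E <= #|cliques (gedge w) S 2|)%N]
   <= (3 * INR #|S| ^ 2 / (INR E * INR m.+1)) ^ E)%R.
Proof.
move=> E0; have E0' := INR_gt0 E0; have [i0 i1] := inv_INR_bounds m.
have m0 := INR_gt0 (ltn0Sn m).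
pose D := [set X : {set {set 'I_n}} | X \subset pairs S & #|X| == E].
pose Ev (X : {set {set 'I_n}}) : {set {ffun {set 'I_n} -> 'I_m.+1}} :=
  [set w : {ffun {set 'I_n} -> 'I_m.+1} | [forall x in X, w x == ord0]].
apply: Rle_trans (_ : _ <= Pr (\bigcup_(X in D) Ev X))%R _.
  apply: Pr_le; apply/subsetP => w; rewrite inE => /subset_of_card[X [XC cX]].
  apply/bigcupP; exists X; rewrite inE ?cX ?eqxx ?andbT.
    apply/subsetP => A /(subsetP XC); rewrite inE => /and3P[AS cA _].
    by rewrite inE AS.
  apply/forall_inP => x xX; have xC := subsetP XC x xX; apply: (clique_pairs xC).
  by move: xC; rewrite !inE subxx => /and3P[].
have PD X : X \in D -> (Pr (Ev X) <= (/ INR m.+1) ^ E)%R.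
  by rewrite inE => /andP[_ /eqP <-]; rewrite Pr_all0; exact: Rle_refl.
apply: Rle_trans (Pr_bigcup PD) _.
rewrite cards_draws card_pairs.
have -> : (3 * INR #|S| ^ 2 / (INR E * INR m.+1) =
           (3 * INR (#|S| ^ 2) / INR E) * / INR m.+1)%R.
  by rewrite INR_expn; field; lra.
rewrite Rpow_mult_distr; apply: Rmult_le_compat_r; first by apply: pow_le; lra.
apply: Rle_trans (INR_bin_upper _ E0) _; apply: pow_incr; split.
  by apply: Rmult_le_pos; [have := pos_INR 'C(#|S|, 2); lra | apply/Rlt_le/Rinv_0_lt_compat].
apply: Rmult_le_compat_r; first by apply/Rlt_le/Rinv_0_lt_compat.
by apply: Rmult_le_compat_l; [lra | apply/INR_leq/leq_bin_expn].
Qed.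

(** Edge-disjoint triangles involve [3 k] distinct pairs, so a fixed family is present with
    probability at most [(m + 1)^(-3k)]. Triangles sharing edges would lack this independence. *)
Lemma Pr_packing_ge (n m k : nat) (S : {set 'I_n}) : 0 < k ->
  (Pr [set w : {ffun {set 'I_n} -> 'I_m.+1} |
        [exists F : {set {set 'I_n}},
           [&& F \subset cliques (gedge w) S 3, edge_disjoint F & #|F| == k]]]
   <= (3 * INR #|S| ^ 3 / (INR k * INR m.+1 ^ 3)) ^ k)%R.
Proof.
move=> k0; have k0' := INR_gt0 k0; have [i0 i1] := inv_INR_bounds m.
have m0 := INR_gt0 (ltn0Sn m).
pose T := [set A : {set 'I_n} | A \subset S & #|A| == 3].
pose D0 := [set F : {set {set 'I_n}} | F \subset T & #|F| == k].
pose D := [set F in D0 | edge_disjoint F].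
pose Ev (F : {set {set 'I_n}}) : {set {ffun {set 'I_n} -> 'I_m.+1}} :=
  [set w : {ffun {set 'I_n} -> 'I_m.+1} | [forall x in \bigcup_(A in F) pairs A, w x == ord0]].
apply: Rle_trans (_ : _ <= Pr (\bigcup_(F in D) Ev F))%R _.
  apply: Pr_le; apply/subsetP => w; rewrite inE => /existsP[F /and3P[FC dF cF]].
  apply/bigcupP; exists F.
    rewrite !inE cF dF !andbT; apply/subsetP => A /(subsetP FC).
    by rewrite !inE => /and3P[-> ->].
  rewrite inE; apply/forall_inP => x /bigcupP[A AF]; apply: clique_pairs.
  exact: (subsetP FC).
have PD F : F \in D -> (Pr (Ev F) <= (/ INR m.+1) ^ (3 * k))%R.
  rewrite !inE => /andP[/andP[/subsetP FT /eqP cF] dF].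
  rewrite Pr_all0 -cF.
  have le3 : 3 * #|F| <= #|\bigcup_(A in F) pairs A|.
    by apply: card_bigcup_pairs => // A /FT; rewrite inE => /andP[_ /eqP].
  rewrite -(subnKC le3) Rdef_pow_add -[X in (_ <= X)%R]Rmult_1_r.
  apply: Rmult_le_compat_l; first by apply: pow_le; lra.
  by rewrite -[X in (_ <= X)%R](pow1 (#|\bigcup_(A in F) pairs A| - 3 * #|F|)); apply: pow_incr; lra.
apply: Rle_trans (Pr_bigcup PD) _.
have cD : (INR #|D| <= (3 * INR (#|S| ^ 3) / INR k) ^ k)%R.
  apply: Rle_trans (_ : _ <= INR 'C('C(#|S|, 3), k))%R _.
    apply: INR_leq; rewrite -cards_draws -cards_draws -/T.
    by apply/subset_leq_card/subsetP => F; rewrite inE => /andP[].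
  apply: Rle_trans (INR_bin_upper _ k0) _; apply: pow_incr; split.
    by apply: Rmult_le_pos; [have := pos_INR 'C(#|S|, 3); lra | apply/Rlt_le/Rinv_0_lt_compat].
  apply: Rmult_le_compat_r; first by apply/Rlt_le/Rinv_0_lt_compat.
  by apply: Rmult_le_compat_l; [lra | apply/INR_leq/leq_bin_expn].
have -> : (3 * INR #|S| ^ 3 / (INR k * INR m.+1 ^ 3) =
           (3 * INR (#|S| ^ 3) / INR k) * (/ INR m.+1) ^ 3)%R.
  by rewrite INR_expn; field; lra.
rewrite Rpow_mult_distr -pow_mult; apply: Rmult_le_compat_r => //.
by apply: pow_le; lra.
Qed.

Lemma Pr_no_independent_sparse (n m s t b B E k : nat) :
  0 < E -> 0 < k ->
  2 * (2 * E + 9 * ((32 ^ b).+1 * k)) < s * B.+1 ->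
  4 * t * (B + 32 ^ b) <= s * b ->
  (Pr [set w : {ffun {set 'I_n} -> 'I_m.+1} |
        [exists S : {set 'I_n}, (#|S| == s) && no_independent (gedge w) t S]]
   <= INR n ^ s * ((3 * INR s ^ 2 / (INR E * INR m.+1)) ^ E
                   + (3 * INR s ^ 3 / (INR k * INR m.+1 ^ 3)) ^ k))%R.
Proof.
move=> E0 k0 hB ht.
set x := (_ + _)%R.
pose D := [set S : {set 'I_n} | #|S| == s].
pose Ev1 (S : {set 'I_n}) :=
  [set w : {ffun {set 'I_n} -> 'I_m.+1} | (E <= #|cliques (gedge w) S 2|)%N].
pose Ev2 (S : {set 'I_n}) := [set w : {ffun {set 'I_n} -> 'I_m.+1} |
        [exists F : {set {set 'I_n}},
           [&& F \subset cliques (gedge w) S 3, edge_disjoint F & #|F| == k]]].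
apply: Rle_trans (_ : _ <= Pr (\bigcup_(S in D) (Ev1 S :|: Ev2 S)))%R _.
  apply: Pr_le; apply/subsetP => w; rewrite inE => /existsP[S /andP[/eqP cS]].
  move=> noS; apply/bigcupP; exists S; first by rewrite inE cS.
  rewrite in_setU; apply: contraLR noS; rewrite negb_or !inE -ltnNge => /andP[hE].
  move=> /existsPn hF.
  apply: (@sparse_has_independent _ b _ B E k) => //; rewrite ?cS //.
  - exact: gedge_simple.
  - exact: ltnW.
  (* A larger family contains one with exactly [k] members, as in the event [Ev2]. *)
  move=> F FC dF; rewrite leqNgt; apply/negP => /ltnW /subset_of_card[G [GF cG]].
  have := hF G; rewrite cG eqxx (subset_trans GF FC) andbT /= => /negP; apply.
  apply/forall_inP => A AG; apply/forall_inP => C CG.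
  exact: (forall_inP (forall_inP dF A (subsetP GF A AG)) C (subsetP GF C CG)).
have PD S : S \in D -> (Pr (Ev1 S :|: Ev2 S) <= x)%R.
  rewrite inE => /eqP cS; apply: Rle_trans (Pr_setU _ _) _.
  by apply: Rplus_le_compat; rewrite -cS; [apply: Pr_edges_ge | apply: Pr_packing_ge].
apply: Rle_trans (Pr_bigcup PD) _; apply: Rmult_le_compat_r.
  apply: Rplus_le_le_0_compat; apply: pow_le;
    apply: Rmult_le_pos; try (apply/Rlt_le/Rinv_0_lt_compat/Rmult_lt_0_compat; try apply: pow_lt; exact: INR_gt0);
    by apply: Rmult_le_pos; [lra | apply/pow_le/pos_INR].
rewrite -INR_expn; apply: INR_leq; rewrite card_draws card_ord; exact: leq_bin_expn.
Qed.

(** * Case (b) *)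

(** [B] is the least value allowed by the first inequality. With [z = exp (eps L / 2)] and
    [y = exp ((1 - eps) L)], so that [exp L = y z^2], edges contribute at most [exp L * b / 8] to
    [B]. The rest and [32^b] add at most [77 z y <= exp L / 8], whence 616. *)
Lemma sparse_threshold (s t b m E k : nat) (L eps : R) :
  0 < t -> 0 < b -> (0 <= L)%R -> (0 < eps <= 1)%R ->
  (INR s = INR t * exp L)%R ->
  (288 * INR t <= INR b * INR m.+1)%R ->
  (INR E <= 9 * INR s ^ 2 / INR m.+1 + 1)%R ->
  (INR k <= 2 * INR s * exp ((1 - eps) * L))%R ->
  (INR (32 ^ b) <= exp (eps / 2 * L))%R ->
  (616 <= exp (eps / 2 * L))%R ->
  exists B : nat, 2 * (2 * E + 9 * ((32 ^ b).+1 * k)) < s * B.+1 /\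
    4 * t * (B + 32 ^ b) <= s * b.
Proof.
move=> t0 b0 L0 [e0 e1] sE Mb hE hk hD h616.
have t0' := INR_gt0 t0; have b1 := INR_ge1 b0; have m0 := INR_gt0 (ltn0Sn m).
have t1 := INR_ge1 t0.
have lam1 : (1 <= exp L)%R by have := exp_ineq1_le L; lra.
have s1 : (1 <= INR s)%R by rewrite sE; nra.
have s0 : 0 < s by case: (s) s1 => //=; lra.
set T := 2 * (2 * E + _).
exists (T %/ s); split; first by rewrite mulnC; apply: ltn_ceil.
have BT : (INR (T %/ s) * INR s <= INR T)%R.
  by rewrite -INR_muln; apply: INR_leq; apply: leq_divM.
set B := T %/ s in BT *.
have D1 : (1 <= INR (32 ^ b))%R by apply: INR_ge1; rewrite expn_gt0.
have TE : INR T = (4 * INR E + 18 * (INR (32 ^ b) + 1) * INR k)%R.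
  by rewrite /T !(INR_muln, INR_addn, S_INR) /=; lra.
move: BT hD TE D1; move: (32 ^ b) => D BT hD TE D1.
suff : (4 * INR t * (INR B + INR D) <= INR s * INR b)%R.
  move=> h; apply/leP/INR_le; rewrite !(INR_muln, INR_addn).
  by rewrite (_ : INR 4 = 4%R) //=; lra.
pose y := exp ((1 - eps) * L); pose z := exp (eps / 2 * L).
have y0 : (0 < y)%R by exact: exp_pos.
have lam : (exp L = y * z * z)%R by rewrite /y /z -!exp_plus; congr exp; lra.
have y1 : (1 <= y)%R.
  have := exp_ineq1_le ((1 - eps) * L).
  by have := Rmult_le_pos (1 - eps) L ltac:(lra) L0; rewrite /y; lra.
rewrite -/y in hk; rewrite -/z in hD h616.
have sM : (36 * INR s ^ 2 / INR m.+1 <= INR s * exp L * INR b / 8)%R.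
  apply: (Rmult_le_reg_r (INR m.+1)) => //.
  have -> : (36 * INR s ^ 2 / INR m.+1 * INR m.+1 = 36 * INR s ^ 2)%R by field; lra.
  have sl0 : (0 <= INR s * exp L / 8)%R by apply: Rmult_le_pos; [apply: Rmult_le_pos|]; lra.
  have := Rmult_le_compat_l _ _ _ sl0 Mb.
  have -> : (INR s * exp L / 8 * (288 * INR t) = 36 * INR s * (INR t * exp L))%R by field.
  by rewrite -sE; lra.
have hT : (INR T <= INR s * exp L * INR b / 8 + 4 + 72 * (z * INR s * y))%R.
  rewrite TE.
  have Dk : ((INR D + 1) * INR k <= (2 * z) * (2 * INR s * y))%R.
    by apply: Rmult_le_compat; try lra; apply: pos_INR.
  have : (4 * (9 * INR s ^ 2 / INR m.+1) = 36 * INR s ^ 2 / INR m.+1)%R by field; lra.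
  lra.
have hB : (INR B <= exp L * INR b / 8 + 4 + 72 * (z * y))%R.
  apply: (Rmult_le_reg_r (INR s)); first lra.
  apply: Rle_trans BT _; apply: Rle_trans hT _; nra.
have zy : (616 * (z * y) <= exp L)%R.
  by rewrite lam; have := Rmult_le_compat_l (z * y) _ _ ltac:(nra) h616; lra.
have z_zy : (z <= z * y)%R by nra.
have one_zy : (1 <= z * y)%R by lra.
have lamb : (exp L <= exp L * INR b)%R by nra.
have fin : (INR B + INR D <= exp L * INR b / 4)%R by lra.
have := Rmult_le_compat_l (4 * INR t) _ _ ltac:(lra) fin.
by rewrite {1}sE; lra.
Qed.

Lemma pow_third_small (x : R) (k : nat) : (0 <= x <= / 3)%R -> (x ^ k <= exp (- INR k))%R.
Proof.
move=> hx.
have -> : exp (- INR k) = (exp (- (1)) ^ k)%R.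
  by rewrite pow_exp_ln ?ln_exp; [congr exp; ring | exact: exp_pos].
apply: pow_incr; split; first lra.
apply: Rle_trans (proj2 hx) _; rewrite exp_Ropp; apply: Rinv_le_contravar.
  exact: exp_pos.
exact: exp_le_3.
Qed.

(* The case [s / t < (ln n)^2]: here [t] exceeds every power of [s / t], so that
   [G(s, p)] contains few edge-disjoint triangles. Below, [u = ln (ln n)] and
   [L = ln (s / t)]. *)
Lemma theorem2p4_b_sparse (c g : R) : (0 < c)%R -> (0 < g <= / 2)%R ->
  exists C : R, (9 <= C)%R /\ exists N : nat, forall (C' : R) (n s t : nat),
    (C <= C')%R ->
    (N <= n)%N -> (0 < t)%N -> (t < s)%N -> (2 * s <= n)%N ->
    (INR s <= exp (2 * INR t))%R ->
    (ln c + ln (ln (INR n)) <= ln (INR s / INR t) <= 2 * ln (ln (INR n)))%R ->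
    (exp (g * ln (ln (INR n))) <= ln (INR t))%R ->
    exists e : rel 'I_n, simple_graph e /\
      (INR (alpha e) <= C' * (INR t / ln (INR s / INR t)) * ln (INR n / INR t))%R /\
      (forall S : {set 'I_n}, #|S| = s ->
         exists T : {set 'I_n}, T \subset S /\ #|T| = t /\ independent e T).
Proof.
(* This [eta] ensures that [b <= eta L] gives [32^b <= exp (5 b) <= exp (eps L / 2)]. *)
move=> c0 [g0 g1]; pose eps := (g / 2)%R; pose eta := (eps / 10)%R.
have eps0 : (0 < eps <= / 4)%R by rewrite /eps; lra.
have eta0 : (0 < eta <= / 40)%R by rewrite /eta; lra.
(* Lower bounds on [u]: [u1] gives [L >= u / 2], [u2] gives [b >= 66 / c], [u3] gives the 616, [u4]
   and [u5] serve the triangles. *)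
pose u1 := (2 * Rabs (ln c))%R; pose u2 := (2 * ((66 / c + 3) / eta))%R.
pose u3 := (2464 / eps)%R; pose u4 := (2 * (Rabs (ln c) + 3) / g)%R.
pose u5 := (112 / (g * g))%R.
have ac := Rabs_pos (ln c).
have c0i : (0 < 66 / c)%R by apply: Rdiv_lt_0_compat; lra.
have u1p : (0 <= u1)%R by rewrite /u1; lra.
have u2p : (0 < u2)%R.
  by apply: Rmult_lt_0_compat; [lra | apply: Rdiv_lt_0_compat; lra].
have u3p : (0 < u3)%R by apply: Rdiv_lt_0_compat; lra.
have u4p : (0 < u4)%R by apply: Rdiv_lt_0_compat; lra.
have u5p : (0 < u5)%R by apply: Rdiv_lt_0_compat; [lra | nra].
have [N hN] := ln_INR_large (4 + exp (1 + u1 + u2 + u3 + u4 + u5)).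
exists (9 + 4 * (578 / eta))%R; split.
  by have : (0 < 578 / eta)%R by [apply: Rdiv_lt_0_compat; lra]; lra.
exists N => C n s t hC /hN[n0 ln_n] t0 ts sn st.
have [[L0 L2] sE] := ratio_facts t0 ts st.
have t0' := INR_gt0 t0; have ts' := INR_ltn ts; have t1 := INR_ge1 t0.
move: L0 L2 sE; set L := ln (INR s / INR t) => L0 L2 sE.
have := exp_pos (1 + u1 + u2 + u3 + u4 + u5).
move: ln_n; set l := ln (INR n); set U := exp _ => ln_n U0.
have l4 : (4 <= l)%R by lra.
set u := ln l => -[Lc Lu] ht.
have eu : exp u = l by rewrite /u exp_ln; lra.
have u_big : (1 + u1 + u2 + u3 + u4 + u5 <= u)%R.
  by rewrite -(ln_exp (1 + _ + _ + _ + _ + _)); apply: ln_leq => //; rewrite -/U; lra.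
have lc := Rle_abs (- ln c); rewrite Rabs_Ropp in lc.
have Lu2 : (u / 2 <= L)%R by rewrite /u1 in u_big; lra.
have etaL : (66 / c + 3 <= eta * L)%R.
  have h : ((66 / c + 3) / eta <= L)%R by rewrite /u2 in u_big; lra.
  have := Rmult_le_compat_l eta _ _ ltac:(lra) h.
  have -> : (eta * ((66 / c + 3) / eta) = 66 / c + 3)%R by field; lra.
  by lra.
have z616 : (616 <= exp (eps / 2 * L))%R.
  have h : (1232 / eps <= L)%R.
    have -> : (1232 / eps = u3 / 2)%R by rewrite /u3; field; lra.
    by lra.
  have := Rmult_le_compat_l (eps / 2) _ _ ltac:(lra) h.
  have -> : (eps / 2 * (1232 / eps) = 616)%R by field; lra.
  by have := exp_ineq1_le (eps / 2 * L); lra.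
(* [b] will be one less than this integer, hence at most [eta L]. *)
have [b1 [b_lo b_hi]] := @nat_above (eta * L) ltac:(lra).
case: b1 b_lo b_hi => [|b] b_lo b_hi; first by rewrite /= in b_lo; lra.
rewrite S_INR in b_lo b_hi.
have b66 : (66 / c <= INR b)%R by lra.
have bL : (eta * L / 2 <= INR b)%R by lra.
have b1 : (1 <= INR b)%R by lra.
have b0 : 0 < b by case: (b) b1 => //=; lra.
have b_t : (INR b <= INR t)%R by nra.
have x0 : (0 <= 288 * INR t / INR b)%R by apply/Rlt_le/Rdiv_lt_0_compat; lra.
have [M [M1 M2]] := nat_above x0.
case: M M1 M2 => [|m] M1 M2; first by rewrite /= in M1; lra.
have m0 := INR_gt0 (ltn0Sn m).
have Mb : (288 * INR t <= INR b * INR m.+1)%R.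
  have := Rmult_le_compat_l (INR b) _ _ ltac:(lra) (Rlt_le _ _ M1).
  have -> : (INR b * (288 * INR t / INR b) = 288 * INR t)%R by field; lra.
  by lra.
have Mb2 : (INR b * INR m.+1 <= 289 * INR t)%R.
  have := Rmult_le_compat_l (INR b) _ _ ltac:(lra) M2.
  rewrite Rmult_plus_distr_l.
  have -> : (INR b * (288 * INR t / INR b) = 288 * INR t)%R by field; lra.
  by lra.
(* 578 is twice 289, from [b >= eta L / 2] and [b (m + 1) <= 289 t]. *)
have [|||r [rX Pr1]] := @Pr_alpha_le C (eta / 578) n s t m _ _ t0 ts sn st.
- by have : (0 < 578 / eta)%R by [apply: Rdiv_lt_0_compat; lra]; lra.
- have h : (4 * (578 / eta) <= C)%R by lra.
  have := Rmult_le_compat_r (eta / 578) _ _ ltac:(lra) h.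
  have -> : (4 * (578 / eta) * (eta / 578) = 4)%R by field; lra.
  by lra.
- rewrite -/L; have := Rmult_le_compat_r (INR m.+1) _ _ (Rlt_le _ _ m0) bL; lra.
apply: (good_graph rX Pr1).
have lam0 := exp_pos L.
have s1 : (1 <= INR s)%R by lra.
have s2 : (0 < INR s ^ 2)%R by apply: pow_lt; lra.
have sm1 : (0 < 9 * INR s ^ 2 / INR m.+1)%R by apply: Rdiv_lt_0_compat; lra.
(* This size brings the base in the edge tail to at most [1/3]. *)
have [E [E1 E2]] := nat_above (Rlt_le _ _ sm1).
pose y := exp ((1 - eps) * L); have y0 : (0 < y)%R by exact: exp_pos.
have [k [k1 k2]] := @nat_above (INR s * y) ltac:(nra).
have y1 : (1 <= y)%R.
  by have := exp_ineq1_le ((1 - eps) * L); have := Rmult_le_pos (1 - eps) L ltac:(lra) (Rlt_le _ _ L0); rewrite /y; lra.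
have sy1 : (1 <= INR s * y)%R by nra.
have k_hi : (INR k <= 2 * INR s * y)%R by lra.
have E0 : 0 < E.
  by case: (posnP E) => // eE; rewrite eE [INR 0]/= in E1; lra.
have k0 : 0 < k by case: (k) k1 => //=; lra.
have D_hi : (INR (32 ^ b) <= exp (eps / 2 * L))%R.
  rewrite INR_expn.
  have e5 : (32 <= exp 5)%R.
    have -> : exp 5 = (exp 1 ^ 5)%R.
      by rewrite pow_exp_ln ?ln_exp; [congr exp; rewrite /=; lra | exact: exp_pos].
    have -> : 32%R = (2 ^ 5)%R by lra.
    by apply: pow_incr; have := exp_ineq1_le 1; lra.
  apply: Rle_trans (_ : _ <= exp 5 ^ b)%R _.
    have -> : INR 32 = 32%R by rewrite INR_IZR_INZ.
    by apply: pow_incr; lra.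
  rewrite pow_exp_ln ?ln_exp; last exact: exp_pos.
  by apply: exp_leq; rewrite /eta in b_hi; lra.
have eps1 : (0 < eps <= 1)%R by lra.
have [B [hB1 hB2]] := sparse_threshold t0 b0 (Rlt_le _ _ L0)
  eps1 sE Mb E2 k_hi D_hi z616.
apply: Rle_lt_trans (Pr_no_independent_sparse n m E0 k0 hB1 hB2) _.
have E0' := INR_gt0 E0; have k0' := INR_gt0 k0.
have n0' := INR_gt0 n0.
have ns : (INR n ^ s = exp (INR s * l))%R by rewrite pow_exp_ln.
have sl : (4 <= INR s * l)%R by nra.
have ssM : (INR s / INR m.+1 <= exp L * INR b / 288)%R.
  apply: (Rmult_le_reg_r (INR m.+1)) => //.
  have -> : (INR s / INR m.+1 * INR m.+1 = INR s)%R by field; lra.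
  by have := Rmult_le_compat_l (exp L / 288) _ _ ltac:(lra) Mb; lra.
have cl : (c * l <= exp L)%R.
  by rewrite -eu -{1}(exp_ln c) // -exp_plus; apply: exp_leq.
(* The choice of [S] costs [n^s = exp (s l)], so a tail of [exp (-2 s l)] suffices. *)
have small x : (2 * (INR s * l) <= x)%R -> (INR n ^ s * exp (- x) < / 3)%R.
  move=> hx; rewrite ns -exp_plus; apply: Rle_lt_trans inv_exp2_lt.
  by rewrite -exp_Ropp; apply: exp_leq; lra.
have edges : (INR n ^ s * (3 * INR s ^ 2 / (INR E * INR m.+1)) ^ E < / 3)%R.
  apply: Rle_lt_trans (small (INR E) _).
    apply: Rmult_le_compat_l; first by apply: pow_le; lra.
    apply: pow_third_small; split.
      by apply/Rlt_le/Rdiv_lt_0_compat; [lra | apply: Rmult_lt_0_compat].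
    apply: (Rmult_le_reg_r (3 * (INR E * INR m.+1))); first nra.
    have -> : (3 * INR s ^ 2 / (INR E * INR m.+1) * (3 * (INR E * INR m.+1)) = 9 * INR s ^ 2)%R.
      by field; lra.
    have := Rmult_le_compat_r (INR m.+1) _ _ (Rlt_le _ _ m0) (Rlt_le _ _ E1).
    have -> : (9 * INR s ^ 2 / INR m.+1 * INR m.+1 = 9 * INR s ^ 2)%R by field; lra.
    lra.
  (* [E >= 2 s l] follows from [b (m + 1) <= 289 t], [s = t exp L] and [b exp L >= 66 l], as
     [9 * 66 >= 2 * 289]. *)
  apply: Rle_trans (Rlt_le _ _ E1).
  apply: (Rmult_le_reg_r (INR m.+1)) => //.
  have -> : (9 * INR s ^ 2 / INR m.+1 * INR m.+1 = 9 * INR s ^ 2)%R by field; lra.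
  apply: (Rmult_le_reg_r (INR b)); first lra.
  have h1 := Rmult_le_compat_l (2 * (INR s * l)) _ _ ltac:(lra) Mb2.
  have cb : (66 <= c * INR b)%R.
    have := Rmult_le_compat_l c _ _ (Rlt_le _ _ c0) b66.
    have -> : (c * (66 / c) = 66)%R by field; lra.
    by lra.
  have h2 : (66 * l <= exp L * INR b)%R by nra.
  have h3 := Rmult_le_compat_l (INR s * INR t) _ _ ltac:(nra) h2.
  have h4 : (INR s * INR t * (exp L * INR b) = INR s ^ 2 * INR b)%R.
    by rewrite /= {3}sE; ring.
  have h5 : (0 <= INR s * INR t * l)%R by apply: Rmult_le_pos; nra.
  lra.
have triangles : (INR n ^ s * (3 * INR s ^ 3 / (INR k * INR m.+1 ^ 3)) ^ k < / 3)%R.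
  have u1' : (1 <= u)%R by lra.
  have gu : (112 <= g * g * u)%R.
    have h : (u5 <= u)%R by lra.
    have := Rmult_le_compat_l (g * g) _ _ ltac:(nra) h.
    have -> : (g * g * u5 = 112)%R by rewrite /u5; field; lra.
    by lra.
  (* [exp (g u) >= (g u / 2)^2]. As [L <= 2 u] and [u >= 1], this yields [ln t >= 12 L + 4], which
     bounds [exp (2 + 6 L) / t] by [t^(-1/2)] below. *)
  have lnt : (28 * u <= ln (INR t))%R.
    apply: Rle_trans ht.
    have -> : exp (g * u) = (exp (g * u / 2) * exp (g * u / 2))%R.
      by rewrite -exp_plus; congr exp; lra.
    have h := exp_ineq1_le (g * u / 2).
    have gu0 : (0 <= g * u)%R by nra.
    have : ((g * u / 2) * (g * u / 2) <= exp (g * u / 2) * exp (g * u / 2))%R.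
      by apply: Rmult_le_compat; lra.
    have : (112 * u <= g * g * u * u)%R by apply: Rmult_le_compat_r; lra.
    lra.
  have k_t : (INR t <= INR k)%R by nra.
  have lamL : (L <= exp L)%R by have := exp_ineq1_le L; lra.
  have sM2 : (INR s / INR m.+1 <= exp L * exp L)%R.
    apply: Rle_trans ssM _; rewrite /Rdiv Rmult_assoc; apply: Rmult_le_compat_l; first lra.
    have : (eta * L <= L)%R by nra.
    by lra.
  have sm0 : (0 < INR s / INR m.+1)%R by apply: Rdiv_lt_0_compat; lra.
  have p_le : (0 <= 3 * INR s ^ 3 / (INR k * INR m.+1 ^ 3) <= exp (- (ln (INR t) / 2)))%R.
    have -> : (3 * INR s ^ 3 / (INR k * INR m.+1 ^ 3) = 3 * (INR s / INR m.+1) ^ 3 / INR k)%R.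
      by field; lra.
    split.
      by apply/Rlt_le/Rdiv_lt_0_compat => //; apply: Rmult_lt_0_compat; [lra | apply: pow_lt].
    apply: Rle_trans (_ : _ <= exp 2 * (exp L * exp L) ^ 3 / INR t)%R _.
      apply: Rmult_le_compat.
      - by apply: Rmult_le_pos; [lra | apply: pow_le; lra].
      - by apply/Rlt_le/Rinv_0_lt_compat.
      - apply: Rmult_le_compat; [lra | by apply: pow_le; lra | | by apply: pow_incr; lra].
        by have := exp_ineq1_le 2; lra.
      exact: Rinv_le_contravar.
    have -> : ((exp L * exp L) ^ 3 = exp (6 * L))%R.
      by rewrite -exp_plus pow_exp_ln ?ln_exp; [congr exp; rewrite /=; lra | exact: exp_pos].
    rewrite -{1}(exp_ln (INR t)) // /Rdiv -exp_Ropp -!exp_plus; apply: exp_leq; lra.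
  apply: Rle_lt_trans (small (INR k * (ln (INR t) / 2))%R _).
    apply: Rmult_le_compat_l; first by apply: pow_le; lra.
    apply: Rle_trans (pow_incr _ _ k p_le) _.
    rewrite pow_exp_ln ?ln_exp; last exact: exp_pos.
    by apply: Req_le; congr exp; ring.
  (* By [L >= u + ln c] and [eps = g / 2], the exponent on the right is at least
     [u + g u / 2 - |ln c|], which [u4] makes at least [u + 3]. *)
  have hy : (4 * l <= y * exp (g * u))%R.
    rewrite -eu /y -exp_plus.
    have e4 : (4 <= exp 3)%R by have := exp_ineq1_le 3; lra.
    apply: Rle_trans (_ : _ <= exp 3 * exp u)%R _.
      by apply: Rmult_le_compat_r => //; apply/Rlt_le/exp_pos.
    rewrite -exp_plus; apply: exp_leq.
    have h : (u4 <= u)%R by lra.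
    have := Rmult_le_compat_l (g / 2) _ _ ltac:(lra) h.
    have -> : (g / 2 * u4 = Rabs (ln c) + 3)%R by rewrite /u4; field; lra.
    have := Rmult_le_compat_l (1 - eps) _ _ ltac:(lra) Lc.
    have : ((1 - eps) * Rabs (ln c) <= Rabs (ln c))%R by nra.
    have := Rmult_le_compat_l (1 - eps) _ _ ltac:(lra) lc.
    rewrite /eps; lra.
  have h1 : (y * exp (g * u) <= y * ln (INR t))%R by apply: Rmult_le_compat_l; lra.
  have h2 : (INR s * (4 * l) <= INR s * (y * ln (INR t)))%R by apply: Rmult_le_compat_l; lra.
  have h3 : (INR s * y * ln (INR t) <= INR k * ln (INR t))%R.
    by apply: Rmult_le_compat_r; lra.
  lra.
rewrite Rmult_plus_distr_l; lra.
Qed.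

(** * Splitting case (b) according to whether [(s/t)^(1/2) >= ln n] *)

Theorem theorem2p4 :
  (* case (a) *)
  (forall delta : R, (0 < delta)%R ->
    exists C : R, (0 < C)%R /\ exists N : nat, forall n s t : nat,
      (N <= n)%N -> (0 < t)%N -> (t < s)%N -> (2 * s <= n)%N ->
      (INR s <= exp (2 * INR t))%R ->
      (Rpower (INR s / INR t) (1 - delta) >= ln (INR n))%R ->
      exists e : rel 'I_n, simple_graph e /\
        (INR (alpha e) <= C * (INR t / ln (INR s / INR t)) * ln (INR n / INR t))%R /\
        (forall S : {set 'I_n}, #|S| = s ->
           exists T : {set 'I_n}, T \subset S /\ #|T| = t /\ independent e T))
  /\
  (* case (b) *)
  (forall c gamma : R, (0 < c)%R -> (0 < gamma)%R ->
    exists C : R, (0 < C)%R /\ exists N : nat, forall n s t : nat,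
      (N <= n)%N -> (0 < t)%N -> (t < s)%N -> (2 * s <= n)%N ->
      (INR s <= exp (2 * INR t))%R ->
      (INR s / INR t >= c * ln (INR n))%R ->
      (ln (INR t) >= Rpower (ln (INR n)) gamma)%R ->
      exists e : rel 'I_n, simple_graph e /\
        (INR (alpha e) <= C * (INR t / ln (INR s / INR t)) * ln (INR n / INR t))%R /\
        (forall S : {set 'I_n}, #|S| = s ->
           exists T : {set 'I_n}, T \subset S /\ #|T| = t /\ independent e T)).
Proof.
split; first exact: theorem2p4_a.
(* Lowering the exponent to at most [1/2] weakens the hypothesis on [t], because [ln n >= 1]. *)
move=> c gamma c0 gamma0; pose g := Rmin gamma (/ 2).
have g0 : (0 < g <= / 2)%R.
  by split; [apply: Rmin_glb_lt; lra | exact: Rmin_r].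
have [C1 [C10 [N1 hN1]]] := @theorem2p4_a (/ 2) ltac:(lra).
have [C2 [C29 [N2 hN2]]] := theorem2p4_b_sparse c0 g0.
have [N3 hN3] := ln_INR_large 1.
(* One constant for both subcases: each bound survives enlarging its constant. *)
exists (C1 + C2)%R; split; first lra.
exists (maxn N1 (maxn N2 N3)) => n s t.
rewrite !geq_max => /and3P[nN1 nN2 nN3] t0 ts sn st hc hg.
have [n0 l1] := hN3 n nN3.
have [[L0 L2] sE] := ratio_facts t0 ts st.
have t0' := INR_gt0 t0; have ts' := INR_ltn ts.
have sn' := INR_leq sn; rewrite INR_muln [INR 2]/= in sn'.
have st0 : (0 < INR s / INR t)%R by apply: Rdiv_lt_0_compat; lra.
(* The first subcase is case (a) with [delta = 1/2]; the second gives [L < 2 ln (ln n)]. *)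
case: (Rle_dec (ln (INR n)) (Rpower (INR s / INR t) (1 - / 2))) => [dense|sparse].
  have [e [sg [ae he]]] := hN1 n s t nN1 t0 ts sn st (Rle_ge _ _ dense).
  exists e; split=> //; split=> //; apply: Rle_trans ae _.
  have LN : (0 <= ln (INR n / INR t))%R.
    rewrite -ln_1; apply: ln_leq; first lra.
    apply: (Rmult_le_reg_r (INR t)) => //; rewrite /Rdiv Rmult_assoc Rinv_l; lra.
  apply: Rmult_le_compat_r => //; apply: Rmult_le_compat_r; last lra.
  by apply/Rlt_le/Rdiv_lt_0_compat.
apply: hN2 => //; first lra.
- split.
    by rewrite -ln_mult //; [apply: ln_leq; [nra | lra] | lra].
  have := Rnot_le_lt _ _ sparse; rewrite /Rpower => h.
  by have := ln_increasing _ _ (exp_pos _) h; rewrite ln_exp; lra.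
have u0 : (0 <= ln (ln (INR n)))%R by rewrite -ln_1; apply: ln_leq; lra.
apply: Rle_trans (Rge_le _ _ hg); apply: exp_leq; apply: Rmult_le_compat_r => //.
exact: Rmin_l.
Qed.
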